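(* Every consistent set $\Phi\subseteq Fm(C)$ (w.r.t. $\vdash_3$) has a normal model, i.e., there exist a normal $S3^\forall_\equiv$-model $\mathcal{M}$ and an assignment $\gamma$ with $(\mathcal{M},\gamma)\vDash\Phi$.
   Context: Language: $Fm(C)$ is the set of formulas built from propositional variables $V$, a set $C$ of propositional constants containing $\top,\bot$, connectives $\neg,\rightarrow,\vee,\wedge$, identity connective $\equiv$, necessity $\square$ and universal propositional quantifier $\forall$ ($\forall x\varphi$ formed only if $x$ free in $\varphi$). $\varphi[x:=\psi]$ is capture-avoiding substitution; $=_\alpha$ is alpha-congruence. The system $S3^\forall_\equiv$ has axioms: (i) substitution-instances of propositional tautologies; (ii) $\square\varphi\rightarrow\varphi$; (iii) $\square(\varphi\rightarrow\psi)\rightarrow(\square\varphi\rightarrow\square\psi)$; (iv) $\square(\varphi\rightarrow\psi)\rightarrow\square(\square\varphi\rightarrow\square\psi)$; (v) $\varphi\equiv\psi$ if $\varphi=_\alpha\psi$; (vi) $(\varphi\equiv\psi)\rightarrow(\varphi\rightarrow\psi)$; (vii) $(\psi\equiv\psi')\rightarrow(\varphi[x:=\psi]\equiv\varphi[x:=\psi'])$, $x$ free in $\varphi$; (viii) $\forall x(\varphi\equiv\psi)\rightarrow(\forall x\varphi\equiv\forall x\psi)$; (ix) $\forall x\varphi\rightarrow\varphi[x:=\psi]$; (x) $\forall x(\varphi\rightarrow\psi)\rightarrow(\forall x\varphi\rightarrow\forall x\psi)$; (xi) $\forall x(\varphi\rightarrow\psi)\rightarrow(\varphi\rightarrow\forall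 x\psi)$, $x$ not free in $\varphi$; (xii) $\square\forall x\varphi\rightarrow\forall x\square\varphi$; (xiii) $\forall x\square\varphi\rightarrow\square\forall x\varphi$; closed under: $\varphi$ axiom and $x$ free in $\varphi$ implies $\forall x\varphi$ axiom. Rules: Modus Ponens and Axiom Necessitation (from an axiom $\varphi$ infer $\square\varphi$). $\vdash_3$ is derivability in $S3^\forall_\equiv$. Semantics: a propositional domain is $\mathcal{M}=(M,\mathit{TRUE},\mathit{NEC},f_\bot,f_\top,f_\square,f_\neg,f_\vee,f_\wedge,f_\rightarrow,f_\equiv,f_\forall,\varGamma)$ with $\mathit{TRUE},\mathit{NEC}\subseteq M$, operations of obvious arities, $f_\forall\colon M^M\to M$, $\varGamma\colon C\to M$ with $\varGamma(\bot)=f_\bot,\varGamma(\top)=f_\top$; assignments $\gamma\colon V\to M$ extend homomorphically with $\gamma(c)=\varGamma(c)$ and $\gamma(\forall x\varphi)=f_\forall(m\mapsto\gamma_x^m(\varphi))$. $t\colon M\to M$ is $(\varphi,x,\gamma)$-definable if $t(m)=\gamma_x^m(\varphi)$ for all $m$ (definable if so for some $\varphi,x,\gamma$). With $a\le_\mathcal{M}b:\Leftrightarrow f_\rightarrow(a,b)\in\mathit{NEC}$ and $\approx_\mathcal{M}$ its symmetric part, $\mathcal{M}$ is an $S3^\forall_\equiv$-model if: (1) when $\mathit{NEC}\neq\varnothing$, $\le_\mathcal{M}$ is a preorder making $(M,f_\bot,f_\top,f_\neg,f_\vee,f_\wedge,f_\rightarrow,\le_\mathcal{M})$ a Boolean prealgebra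 ($\approx_\mathcal{M}$ a congruence with Boolean-algebra quotient ordered by $\le_\mathcal{M}$); (2) $f_\bot\notin\mathit{TRUE}$, $f_\top\in\mathit{TRUE}$, classical truth conditions for $f_\rightarrow,f_\neg,f_\wedge,f_\vee$, $f_\square(a)\in\mathit{TRUE}\Leftrightarrow a\in\mathit{NEC}$, $f_\equiv(a,b)\in\mathit{TRUE}\Leftrightarrow a=b$, $f_\forall(t)\in\mathit{TRUE}$ for definable $t$ with image in $\mathit{TRUE}$; (3) when $\mathit{NEC}\neq\varnothing$, $\mathit{NEC}\subseteq\mathit{TRUE}$ is upward closed under $\le_\mathcal{M}$ and closed under $f_\wedge$; (4) when $\mathit{NEC}\neq\varnothing$: $f_\top\le_\mathcal{M}f_\equiv(a,a)$; $f_\equiv(a,b)\le_\mathcal{M}f_\rightarrow(a,b)$; $f_\equiv(a,b)\le_\mathcal{M}f_\equiv(t(a),t(b))$ for definable $t$; $f_\square(a)\le_\mathcal{M}a$; $f_\square(f_\rightarrow(a,b))\le_\mathcal{M}f_\rightarrow(f_\square(a),f_\square(b))$; $f_\square(f_\rightarrow(a,b))\le_\mathcal{M}f_\square(f_\rightarrow(f_\square(a),f_\square(b)))$; $f_\forall(t)\le_\mathcal{M}f_\equiv(f_\forall(t_1),f_\forall(t_2))$ and $f_\forall(t)\le_\mathcal{M}f_\rightarrow(f_\forall(t_1),f_\forall(t_2))$ for $t_1,t_2$ $(\varphi,x,\gamma)$-, $(\psi,x,\gamma)$-definable and $t$ the pointwise $f_\equiv$, resp. $f_\rightarrow$, of $t_1,t_2$;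 $f_\forall(t)\le_\mathcal{M}t(a)$ for definable $t$; $f_\forall(t)\le_\mathcal{M}f_\rightarrow(b,f_\forall(t'))$ for $t'$ $(\psi,x,\gamma)$-definable, $b$ the denotation of a sentence and $t(a)=f_\rightarrow(b,t'(a))$; $f_\square(f_\forall(t))\approx_\mathcal{M}f_\forall(a\mapsto f_\square(t(a)))$ for definable $t$; $f_\forall(t)\in\mathit{NEC}$ for definable $t$ with image in $\mathit{NEC}$. It is normal if $\mathit{NEC}\neq\varnothing$. $(\mathcal{M},\gamma)\vDash\varphi:\Leftrightarrow\gamma(\varphi)\in\mathit{TRUE}$.
   Formalization: In the model condition f_∀(t) ≤ f_≡(f_∀(t_1), f_∀(t_2)), the variable x is required to be free in both φ and ψ (so that ∀xφ, ∀xψ are formulas); without this proviso some consistent sets have no normal model. *)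

(* Defs.v *)
From mathcomp Require Import all_boot.

Set Implicit Arguments.
Unset Strict Implicit.
Unset Printing Implicit Defensive.

Record signature : Type := Signature {
  const :> Type;
  ctop : const;
  cbot : const;
  ctop_neq_cbot : ctop <> cbot }.

(* The propositional variables are x_0, x_1, x_2, ...; x_n is the number n. *)
Notation var := nat (only parsing).

(* Raw formulas; the set Fm(C) is the predicate [wf] below. *)
Inductive form (C : signature) : Type :=
| Var of var
| Const of C
| Neg of form C
| Imp of form C & form C
| Or of form C & form C
| And of form C & form C
| Id of form C & form C
| Box of form C
| All of var & form C.

Arguments Var {C} _.
Arguments Const {C} _.

Definition Top {C : signature} : form C := Const (ctop C).
Definition Bot {C : signature} : form C := Const (cbot C).

Definition update (T : Type) (g : var -> T) (x : var) (m : T) : var -> T :=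
  fun y => if y == x then m else g y.

Section Syntax.
Variable C : signature.
Implicit Types phi psi chi : form C.

Fixpoint fv phi : seq var :=
  match phi with
  | Var x => [:: x]
  | Const _ => [::]
  | Neg p | Box p => fv p
  | Imp p q | Or p q | And p q | Id p q => fv p ++ fv q
  | All x p => [seq y <- fv p | y != x]
  end.

(* Membership in Fm(C): no vacuous quantifiers. *)
Fixpoint wf phi : bool :=
  match phi with
  | Var _ | Const _ => true
  | Neg p | Box p => wf p
  | Imp p q | Or p q | And p q | Id p q => wf p && wf q
  | All x p => (x \in fv p) && wf p
  end.

Definition sentence phi : Prop := wf phi /\ fv phi = [::].

Definition fresh (s : seq var) : var := (foldr maxn 0 s).+1.

(* Simultaneous capture-avoiding substitution. A bound variable is renamed
   only when keeping it would capture a variable of a substituted formula. *)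
Fixpoint msubst (s : var -> form C) phi : form C :=
  match phi with
  | Var x => s x
  | Const c => Const c
  | Neg p => Neg (msubst s p)
  | Imp p q => Imp (msubst s p) (msubst s q)
  | Or p q => Or (msubst s p) (msubst s q)
  | And p q => And (msubst s p) (msubst s q)
  | Id p q => Id (msubst s p) (msubst s q)
  | Box p => Box (msubst s p)
  | All x p =>
      let avoid := flatten [seq fv (s z) | z <- fv (All x p)] in
      let y := if x \in avoid then fresh avoid else x in
      All y (msubst (update s x (Var y)) p)
  end.

Definition subst phi (x : var) psi : form C := msubst (update Var x psi) phi.

Inductive alpha : form C -> form C -> Prop :=
| alpha_refl phi : alpha phi phi
| alpha_sym phi psi : alpha phi psi -> alpha psi phi
| alpha_trans phi psi chi : alpha phi psi -> alpha psi chi -> alpha phi chi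
| alpha_rename x y phi :
    y \notin fv (All x phi) -> alpha (All x phi) (All y (subst phi x (Var y)))
| alpha_Neg p p' : alpha p p' -> alpha (Neg p) (Neg p')
| alpha_Imp p p' q q' : alpha p p' -> alpha q q' -> alpha (Imp p q) (Imp p' q')
| alpha_Or p p' q q' : alpha p p' -> alpha q q' -> alpha (Or p q) (Or p' q')
| alpha_And p p' q q' : alpha p p' -> alpha q q' -> alpha (And p q) (And p' q')
| alpha_Id p p' q q' : alpha p p' -> alpha q q' -> alpha (Id p q) (Id p' q')
| alpha_Box p p' : alpha p p' -> alpha (Box p) (Box p')
| alpha_All x p p' : alpha p p' -> alpha (All x p) (All x p').

End Syntax.

Inductive pform : Type :=
| PVar of nat
| PTop
| PBot
| PNeg of pform
| PImp of pform & pform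
| POr of pform & pform
| PAnd of pform & pform.

Fixpoint peval (v : nat -> bool) (p : pform) : bool :=
  match p with
  | PVar n => v n
  | PTop => true
  | PBot => false
  | PNeg p => ~~ peval v p
  | PImp p q => peval v p ==> peval v q
  | POr p q => peval v p || peval v q
  | PAnd p q => peval v p && peval v q
  end.

Definition tautology (p : pform) : Prop := forall v, peval v p.

Fixpoint pinst (C : signature) (s : nat -> form C) (p : pform) : form C :=
  match p with
  | PVar n => s n
  | PTop => Top
  | PBot => Bot
  | PNeg p => Neg (pinst s p)
  | PImp p q => Imp (pinst s p) (pinst s q)
  | POr p q => Or (pinst s p) (pinst s q)
  | PAnd p q => And (pinst s p) (pinst s q)
  end.

Section Deduction.
Variable C : signature.
Implicit Types phi psi : form C.

(* Instances of the schemes among raw formulas; [is_axiom] keeps only those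
   that belong to Fm(C). *)
Inductive scheme : form C -> Prop :=
| sch_taut p s : tautology p -> scheme (pinst s p)
| sch_T phi : scheme (Imp (Box phi) phi)
| sch_K phi psi :
    scheme (Imp (Box (Imp phi psi)) (Imp (Box phi) (Box psi)))
| sch_S3 phi psi :
    scheme (Imp (Box (Imp phi psi)) (Box (Imp (Box phi) (Box psi))))
| sch_alpha phi psi : alpha phi psi -> scheme (Id phi psi)
| sch_Id_Imp phi psi : scheme (Imp (Id phi psi) (Imp phi psi))
| sch_Id_subst phi x psi psi' : x \in fv phi ->
    scheme (Imp (Id psi psi') (Id (subst phi x psi) (subst phi x psi')))
| sch_All_Id x phi psi :
    scheme (Imp (All x (Id phi psi)) (Id (All x phi) (All x psi)))
| sch_All_inst x phi psi : scheme (Imp (All x phi) (subst phi x psi))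
| sch_All_Imp x phi psi :
    scheme (Imp (All x (Imp phi psi)) (Imp (All x phi) (All x psi)))
| sch_All_Imp_const x phi psi : x \notin fv phi ->
    scheme (Imp (All x (Imp phi psi)) (Imp phi (All x psi)))
| sch_Box_All x phi : scheme (Imp (Box (All x phi)) (All x (Box phi)))
| sch_Barcan x phi : scheme (Imp (All x (Box phi)) (Box (All x phi))).

Inductive is_axiom : form C -> Prop :=
| axiom_scheme phi : wf phi -> scheme phi -> is_axiom phi
| axiom_All x phi : is_axiom phi -> x \in fv phi -> is_axiom (All x phi).

Inductive derives (Phi : form C -> Prop) : form C -> Prop :=
| der_hyp phi : Phi phi -> derives Phi phi
| der_axiom phi : is_axiom phi -> derives Phi phi
| der_AN phi : is_axiom phi -> derives Phi (Box phi)
| der_MP phi psi :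
    derives Phi phi -> derives Phi (Imp phi psi) -> derives Phi psi.

Definition consistent (Phi : form C -> Prop) : Prop := ~ derives Phi Bot.

End Deduction.

Record domain (C : signature) : Type := Domain {
  carrier :> Type;
  TRUE : carrier -> Prop;
  NEC : carrier -> Prop;
  fbot : carrier;
  ftop : carrier;
  fbox : carrier -> carrier;
  fneg : carrier -> carrier;
  for_ : carrier -> carrier -> carrier;
  fand : carrier -> carrier -> carrier;
  fimp : carrier -> carrier -> carrier;
  fid : carrier -> carrier -> carrier;
  fall : (carrier -> carrier) -> carrier;
  Gamma : C -> carrier;
  Gamma_bot : Gamma (cbot C) = fbot;
  Gamma_top : Gamma (ctop C) = ftop }.

Arguments TRUE {C M} _ : rename.
Arguments NEC {C M} _ : rename.
Arguments fbot {C} M : rename.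
Arguments ftop {C} M : rename.
Arguments fbox {C M} _ : rename.
Arguments fneg {C M} _ : rename.
Arguments for_ {C M} _ _ : rename.
Arguments fand {C M} _ _ : rename.
Arguments fimp {C M} _ _ : rename.
Arguments fid {C M} _ _ : rename.
Arguments fall {C M} _ : rename.
Arguments Gamma {C} M _ : rename.

(* The Boolean-algebra laws of the quotient of T by the symmetric part [eqv]
   of [le] are written as laws on T modulo [eqv]; [bpa_le] says that the order
   induced by [le] on the quotient is the lattice order. *)
Section BooleanPrealgebra.
Variables (T : Type) (bot top : T) (neg : T -> T) (join meet imp : T -> T -> T).
Variable le : T -> T -> Prop.

Local Notation eqv a b := (le a b /\ le b a).

Record boolean_prealgebra : Prop := BooleanPrealgebra {
  bpa_refl : forall a, le a a;
  bpa_trans : forall a b c, le a b -> le b c -> le a c;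
  bpa_neg_congr : forall a a', eqv a a' -> eqv (neg a) (neg a');
  bpa_join_congr : forall a a' b b',
    eqv a a' -> eqv b b' -> eqv (join a b) (join a' b');
  bpa_meet_congr : forall a a' b b',
    eqv a a' -> eqv b b' -> eqv (meet a b) (meet a' b');
  bpa_imp_congr : forall a a' b b',
    eqv a a' -> eqv b b' -> eqv (imp a b) (imp a' b');
  bpa_joinC : forall a b, eqv (join a b) (join b a);
  bpa_meetC : forall a b, eqv (meet a b) (meet b a);
  bpa_joinA : forall a b c, eqv (join a (join b c)) (join (join a b) c);
  bpa_meetA : forall a b c, eqv (meet a (meet b c)) (meet (meet a b) c);
  bpa_joinK : forall a b, eqv (join a (meet a b)) a;
  bpa_meetK : forall a b, eqv (meet a (join a b)) a;
  bpa_distr : forall a b c,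
    eqv (meet a (join b c)) (join (meet a b) (meet a c));
  bpa_join_neg : forall a, eqv (join a (neg a)) top;
  bpa_meet_neg : forall a, eqv (meet a (neg a)) bot;
  bpa_imp : forall a b, eqv (imp a b) (join (neg a) b);
  bpa_le : forall a b, le a b <-> eqv (meet a b) a }.

End BooleanPrealgebra.

Section Semantics.
Variables (C : signature) (M : domain C).
Implicit Types (g : var -> M) (phi psi : form C) (x : var).
Implicit Types (a b : M) (t : M -> M).

Fixpoint den g phi : M :=
  match phi with
  | Var x => g x
  | Const c => Gamma M c
  | Neg p => fneg (den g p)
  | Imp p q => fimp (den g p) (den g q)
  | Or p q => for_ (den g p) (den g q)
  | And p q => fand (den g p) (den g q)
  | Id p q => fid (den g p) (den g q)
  | Box p => fbox (den g p)
  | All x p => fall (fun m => den (update g x m) p)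
  end.

Definition definable_by phi x g t : Prop :=
  wf phi /\ forall m, t m = den (update g x m) phi.

Definition definable t : Prop := exists phi x g, definable_by phi x g t.

Definition le a b : Prop := NEC (fimp a b).

Definition approx a b : Prop := le a b /\ le b a.

Definition normal : Prop := exists a : M, NEC a.

Record truth_conditions : Prop := TruthConditions {
  true_bot : ~ TRUE (fbot M);
  true_top : TRUE (ftop M);
  true_imp : forall a b, TRUE (fimp a b) <-> (~ TRUE a \/ TRUE b);
  true_neg : forall a, TRUE (fneg a) <-> ~ TRUE a;
  true_and : forall a b, TRUE (fand a b) <-> (TRUE a /\ TRUE b);
  true_or : forall a b, TRUE (for_ a b) <-> (TRUE a \/ TRUE b);
  true_box : forall a, TRUE (fbox a) <-> NEC a;
  true_id : forall a b, TRUE (fid a b) <-> a = b;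
  true_all : forall t, definable t -> (forall a, TRUE (t a)) -> TRUE (fall t) }.

Record NEC_filter : Prop := NECFilter {
  NEC_TRUE : forall a, NEC a -> TRUE a;
  NEC_up : forall a b, NEC a -> le a b -> NEC b;
  NEC_and : forall a b, NEC a -> NEC b -> NEC (fand a b) }.

(* In [le_all_id], "x free in phi and in psi" says that All x phi and
   All x psi are formulas, as in the axiom scheme [sch_All_Id] that the clause
   interprets. The proviso cannot be dropped: for phi = y, a variable distinct
   from x, the element fall (fun=> g y) would then witness
     exists z, /\_(i = 1, 2)
       Box (All x (Id y psi_i) -> Id z (All x psi_i))
   in every normal model, and for psi_i = (p_i \/ x) this formula is not
   derivable, so its negation is consistent. *)
Record order_conditions : Prop := OrderConditions {
  le_id_refl : forall a, le (ftop M) (fid a a);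
  le_id_imp : forall a b, le (fid a b) (fimp a b);
  le_id_subst : forall t, definable t ->
    forall a b, le (fid a b) (fid (t a) (t b));
  le_box : forall a, le (fbox a) a;
  le_box_imp : forall a b, le (fbox (fimp a b)) (fimp (fbox a) (fbox b));
  le_box_imp_box : forall a b,
    le (fbox (fimp a b)) (fbox (fimp (fbox a) (fbox b)));
  le_all_id : forall phi psi x g t1 t2,
    x \in fv phi -> x \in fv psi ->
    definable_by phi x g t1 -> definable_by psi x g t2 ->
    le (fall (fun a => fid (t1 a) (t2 a))) (fid (fall t1) (fall t2));
  le_all_imp : forall phi psi x g t1 t2,
    definable_by phi x g t1 -> definable_by psi x g t2 ->
    le (fall (fun a => fimp (t1 a) (t2 a))) (fimp (fall t1) (fall t2));
  le_all_inst : forall t, definable t -> forall a, le (fall t) (t a);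
  le_all_imp_const : forall psi x g t' sigma b,
    definable_by psi x g t' -> sentence sigma -> b = den g sigma ->
    le (fall (fun a => fimp b (t' a))) (fimp b (fall t'));
  approx_box_all : forall t, definable t ->
    approx (fbox (fall t)) (fall (fun a => fbox (t a)));
  NEC_all : forall t, definable t -> (forall a, NEC (t a)) -> NEC (fall t) }.

Record S3_model : Prop := S3Model {
  model_prealgebra : normal ->
    boolean_prealgebra (fbot M) (ftop M) fneg for_ fand fimp le;
  model_truth : truth_conditions;
  model_filter : normal -> NEC_filter;
  model_order : normal -> order_conditions }.

Definition sat g phi : Prop := TRUE (den g phi).

End Semantics.

(* Main.v *)
Require Import Defs.
From Stdlib Require List.
From mathcomp Require Import all_boot.
From mathcomp Require Import boolp classical_sets.

(* Henkin construction with closed formulas. The signature is enlarged by a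
   constant for every variable and a witness constant for every formula with one
   free variable; a formula of the enlarged language is judged derivable when it
   is so in Fm(C) after its new constants are replaced by sufficiently fresh
   variables. Only closed formulas are ever substituted, so no bound variable is
   renamed, and alpha-congruence enters only through renaming to a fresh one.

   The model consists of the sentences modulo provable identity in a maximal
   consistent theory with witnesses. By Barcan and the witnesses, the quantifier
   is interpreted by a greatest lower bound for the strict order, which gives
   most of the order conditions. The identity axiom for quantifiers makes
   All x phi depend only on the function defined by phi as long as x is free in
   phi; any other definable function is constant. *)

Set Implicit Arguments.
Unset Strict Implicit.
Unset Printing Implicit Defensive.

(** * Substitution without renaming *)

(** Necessitation applies to axioms only, so a theory is not closed under boxing what it derives.
    The order of the model is strict implication; each order condition is therefore traced back to
    boxed axioms, combined inside the theory by the K, S3 and Barcan schemes.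

    Working in the calculus of the enlarged language would call for a conservativity proof,
    replacing constants by variables inside axioms whose substitutions may rename bound variables,
    and the names chosen can change under that replacement. Reading derivability back into Fm(C)
    avoids this. The replacing variables have to be large but not distinct: derivability is uniform
    in them, and this uniformity is what allows generalizing over a constant.

    The order conditions also speak of functions defined by formulas in which x is not free, where
    the quantifier axioms have no instance in Fm(C). The greatest lower bound property treats them
    together with the others. *)

Section NaiveSubstitution.

Fixpoint bv (C : signature) (phi : form C) : seq var :=
  match phi with
  | Var _ | Const _ => [::]
  | Neg p | Box p => bv p
  | Imp p q | Or p q | And p q | Id p q => bv p ++ bv q
  | All x p => x :: bv p
  end.

Fixpoint occ (C : signature) (c : C) (phi : form C) : Prop :=
  match phi with
  | Var _ => False
  | Const d => d = c
  | Neg p | Box p | All _ p => occ c p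
  | Imp p q | Or p q | And p q | Id p q => occ c p \/ occ c q
  end.

(* Simultaneous replacement of constants and free variables that never renames
   a bound variable. *)
Fixpoint gsub (C D : signature) (f : C -> form D) (s : var -> form D)
    (phi : form C) : form D :=
  match phi with
  | Var x => s x
  | Const c => f c
  | Neg p => Neg (gsub f s p)
  | Imp p q => Imp (gsub f s p) (gsub f s q)
  | Or p q => Or (gsub f s p) (gsub f s q)
  | And p q => And (gsub f s p) (gsub f s q)
  | Id p q => Id (gsub f s p) (gsub f s q)
  | Box p => Box (gsub f s p)
  | All x p => All x (gsub f (update s x (Var x)) p)
  end.

Definition avoids (C D : signature) (t : form D) (phi : form C) : Prop :=
  forall z, z \in bv phi -> z \notin fv t.

(** Entries with [s w = Var w] are exempt: a free occurrence of [w] is never in the scope of a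
    quantifier over [w], so leaving it in place cannot cause capture. *)
Definition nocap (C D : signature) (f : C -> form D) (s : var -> form D)
    (phi : form C) : Prop :=
  (forall c, avoids (f c) phi) /\
  (forall w, s w = Var w \/ avoids (s w) phi).

Variables C D : signature.
Implicit Types (phi p q r : form C).

Lemma updateE (T : Type) (g : var -> T) x m : update g x m x = m.
Proof. by rewrite /update eqxx. Qed.

Lemma updateN (T : Type) (g : var -> T) x m y : y != x -> update g x m y = g y.
Proof. by rewrite /update => /negbTE ->. Qed.

Lemma avoids_catl (t : form D) p q r : bv r = bv p ++ bv q ->
  avoids t r -> avoids t p.
Proof. by move=> e h z zp; apply: h; rewrite e mem_cat zp. Qed.

Lemma avoids_catr (t : form D) p q r : bv r = bv p ++ bv q ->
  avoids t r -> avoids t q.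
Proof. by move=> e h z zp; apply: h; rewrite e mem_cat zp orbT. Qed.

Lemma nocap_catl (f : C -> form D) s p q r : bv r = bv p ++ bv q ->
  nocap f s r -> nocap f s p.
Proof.
move=> e [hf hs]; split=> [c|w]; first exact: avoids_catl e (hf c).
by case: (hs w) => [->|h]; [left | right; exact: avoids_catl e h].
Qed.

Lemma nocap_catr (f : C -> form D) s p q r : bv r = bv p ++ bv q ->
  nocap f s r -> nocap f s q.
Proof.
move=> e [hf hs]; split=> [c|w]; first exact: avoids_catr e (hf c).
by case: (hs w) => [->|h]; [left | right; exact: avoids_catr e h].
Qed.

Lemma nocap_All (f : C -> form D) s x p : nocap f s (All x p) ->
  nocap f (update s x (Var x)) p.
Proof.
move=> [hf hs]; split=> [c z zp|w]; first by apply: hf; rewrite inE zp orbT.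
have [->|wx] := eqVneq w x; first by left; rewrite updateE.
rewrite updateN //; case: (hs w) => [->|h]; first by left.
by right=> z zp; apply: h; rewrite inE zp orbT.
Qed.

Lemma nocap_All_notin (f : C -> form D) s x p w : nocap f s (All x p) ->
  w != x -> x \notin fv (s w).
Proof.
move=> [_ hs] wx; case: (hs w) => [->|]; first by rewrite inE eq_sym.
by apply; rewrite inE eqxx.
Qed.

Lemma gsub_ext (f f' : C -> form D) s s' phi :
  (forall c, occ c phi -> f c = f' c) ->
  (forall w, w \in fv phi -> s w = s' w) ->
  gsub f s phi = gsub f' s' phi.
Proof.
elim: phi s s' => //= [x|c|p IH|p IHp q IHq|p IHp q IHq|p IHp q IHq
  |p IHp q IHq|p IH|x p IH] s s' hf hs.
- by apply: hs; rewrite inE.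
- exact: hf.
- by rewrite (IH _ s').
- by rewrite (IHp _ s') ?(IHq _ s') // => [c h|w h|c h|w h];
    try (by apply: hf; auto); apply: hs; rewrite mem_cat h ?orbT.
- by rewrite (IHp _ s') ?(IHq _ s') // => [c h|w h|c h|w h];
    try (by apply: hf; auto); apply: hs; rewrite mem_cat h ?orbT.
- by rewrite (IHp _ s') ?(IHq _ s') // => [c h|w h|c h|w h];
    try (by apply: hf; auto); apply: hs; rewrite mem_cat h ?orbT.
- by rewrite (IHp _ s') ?(IHq _ s') // => [c h|w h|c h|w h];
    try (by apply: hf; auto); apply: hs; rewrite mem_cat h ?orbT.
- by rewrite (IH _ s').
- congr All; apply: IH => // w wp; rewrite /update; case: eqP => // /eqP wx.
  by apply: hs; rewrite mem_filter wx.
Qed.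

End NaiveSubstitution.

Section NaiveComposition.
Variables C D E : signature.
Implicit Types phi : form C.

(** Only the inner substitution has to be free of capture. Below a quantifier over [x] the outer one
    is reset at [x], which is harmless because the inserted formulas do not contain [x]; whatever
    the outer one captures is captured on both sides. *)
Lemma gsub_comp (f : C -> form D) s (f' : D -> form E) s' phi : nocap f s phi ->
  gsub f' s' (gsub f s phi) =
  gsub (fun c => gsub f' s' (f c)) (fun w => gsub f' s' (s w)) phi.
Proof.
elim: phi s s' => //= [p IH|p IHp q IHq|p IHp q IHq|p IHp q IHq
  |p IHp q IHq|p IH|x p IH] s s' h; first by rewrite IH.
1-4: by rewrite IHp ?IHq //; [exact: nocap_catr h | exact: nocap_catl h].
- by rewrite IH.
congr All; rewrite IH; last exact: nocap_All.
apply: gsub_ext => [c _|w _].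
- apply: gsub_ext => // z zc; rewrite updateN //; apply: contraTneq zc => ->.
  by apply: h.1; rewrite inE eqxx.
- have [->|wx] := eqVneq w x; first by rewrite !updateE /= updateE.
  rewrite !updateN //; apply: gsub_ext => // z zs; rewrite updateN //.
  by apply: contraTneq zs => ->; exact: nocap_All_notin h wx.
Qed.

Lemma fv_gsub_sub (f : C -> form D) s phi z : (z \in fv (gsub f s phi)) ->
  (exists2 c, occ c phi & z \in fv (f c)) \/
  (exists2 w, w \in fv phi & z \in fv (s w)).
Proof.
elim: phi s => //= [x|c|p IHp q IHq|p IHp q IHq|p IHp q IHq
  |p IHp q IHq|x p IH] s.
- by right; exists x; rewrite ?inE.
- by left; exists c.
1-4: by rewrite mem_cat => /orP[/IHp|/IHq] [[c ? ?]|[w hw ?]];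
  [left; exists c; auto | right; exists w; rewrite ?mem_cat ?hw
  |left; exists c; auto | right; exists w; rewrite ?mem_cat ?hw ?orbT].
rewrite mem_filter => /andP[zx /IH[[c hc zc]|[w hw]]]; first by left; exists c.
have [->|wx] := eqVneq w x; first by rewrite updateE inE (negbTE zx).
by rewrite updateN // => zs; right; exists w; rewrite ?mem_filter ?wx.
Qed.

Lemma fv_gsub_id (f : C -> form D) s phi z : z \in fv phi -> s z = Var z ->
  z \in fv (gsub f s phi).
Proof.
elim: phi s => //= [x|p IHp q IHq|p IHp q IHq|p IHp q IHq
  |p IHp q IHq|x p IH] s.
- by rewrite inE => /eqP -> ->; rewrite inE.
1-4: by rewrite !mem_cat => /orP[/IHp h|/IHq h] /h ->; rewrite ?orbT.
rewrite !mem_filter => /andP[zx zp] sz; rewrite zx; apply: IH => //.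
by rewrite updateN.
Qed.

Lemma bv_gsub (f : C -> form D) s phi :
  (forall c, bv (f c) = [::]) -> (forall w, bv (s w) = [::]) ->
  bv (gsub f s phi) = bv phi.
Proof.
move=> hf; elim: phi s => //= [p IHp q IHq|p IHp q IHq|p IHp q IHq
  |p IHp q IHq|x p IH] s hs; rewrite ?IHp ?IHq ?IH // => w.
by rewrite /update; case: eqP.
Qed.

Lemma wf_gsub (f : C -> form D) s phi :
  (forall c, wf (f c)) -> (forall w, wf (s w)) -> wf phi -> wf (gsub f s phi).
Proof.
move=> hf; elim: phi s => //= [p IHp q IHq|p IHp q IHq|p IHp q IHq
  |p IHp q IHq|x p IH] s hs.
1-4: by case/andP=> wp wq; rewrite IHp ?IHq.
case/andP=> xp wp; rewrite fv_gsub_id ?updateE // IH // => w.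
by rewrite /update; case: eqP.
Qed.

Lemma occ_gsub (f : C -> form D) s phi d :
  occ d (gsub f s phi) ->
  (exists2 c, occ c phi & occ d (f c)) \/ (exists w, occ d (s w)).
Proof.
elim: phi s => //= [x|c|p IHp q IHq|p IHp q IHq|p IHp q IHq|p IHp q IHq
  |x p IH] s.
- by right; exists x.
- by left; exists c.
1-4: by case=> [/IHp|/IHq] [[c ? ?]|?]; [left; exists c; auto | right
  | left; exists c; auto | right].
case/IH=> [?|[w]]; first by left.
by rewrite /update; case: eqP => // _ ?; right; exists w.
Qed.

End NaiveComposition.

Section Substitution.
Variable C : signature.
Implicit Types (phi psi chi : form C) (s : var -> form C).

Lemma gsub_id phi : gsub Const Var phi = phi.
Proof.
elim: phi => //= [p ->|p -> q ->|p -> q ->|p -> q ->|p -> q ->|p ->|x p IH] //.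
congr All; rewrite -[RHS]IH; apply: gsub_ext => // w _.
by rewrite /update; case: eqP => [->|].
Qed.

Lemma gsub_closed s phi : fv phi = [::] -> gsub Const s phi = phi.
Proof.
by move=> h; rewrite -[RHS]gsub_id; apply: gsub_ext => // w; rewrite h.
Qed.

Lemma msubst_gsub s phi : nocap Const s phi -> msubst s phi = gsub Const s phi.
Proof.
elim: phi s => //= [p IH|p IHp q IHq|p IHp q IHq|p IHp q IHq
  |p IHp q IHq|p IH|x p IH] s h; first by rewrite IH.
1-4: by rewrite IHp ?IHq //; [exact: nocap_catr h | exact: nocap_catl h].
- by rewrite IH.
set av := flatten _; have xav : x \notin av.
  apply/negP => /flattenP[u /mapP[z]]; rewrite mem_filter => /andP[zx zp] -> xz.
  by have := nocap_All_notin h zx; rewrite xz.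
by rewrite (negbTE xav) IH //; exact: nocap_All.
Qed.

Lemma subst_Box phi x psi : subst (Box phi) x psi = Box (subst phi x psi).
Proof. by []. Qed.

Lemma subst_Imp phi chi x psi :
  subst (Imp phi chi) x psi = Imp (subst phi x psi) (subst chi x psi).
Proof. by []. Qed.

Lemma subst_Id phi chi x psi :
  subst (Id phi chi) x psi = Id (subst phi x psi) (subst chi x psi).
Proof. by []. Qed.

Lemma nocap_update phi x psi : avoids psi phi ->
  nocap Const (update Var x psi) phi.
Proof.
move=> h; split=> // w; have [->|wx] := eqVneq w x.
  by right; rewrite updateE.
by left; rewrite updateN.
Qed.

Lemma subst_gsub phi x psi : avoids psi phi ->
  subst phi x psi = gsub Const (update Var x psi) phi.
Proof. by move=> h; rewrite /subst msubst_gsub //; exact: nocap_update. Qed.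

Lemma avoids_closed D (phi : form D) psi : fv psi = [::] -> avoids psi phi.
Proof. by move=> e z _; rewrite e. Qed.

Lemma avoids_Var D (phi : form D) y : y \notin bv phi ->
  avoids (Var y : form C) phi.
Proof. by move=> yp z zp; rewrite inE; apply: contraNneq yp => <-. Qed.

Lemma subst_notin phi x psi : avoids psi phi -> x \notin fv phi ->
  subst phi x psi = phi.
Proof.
move=> h xp; rewrite subst_gsub // -[RHS]gsub_id; apply: gsub_ext => // w wp.
by rewrite updateN //; apply: contraNneq xp => <-.
Qed.

Lemma subst_Var_id phi x : subst phi x (Var x) = phi.
Proof.
have e w : update Var x (Var x) w = Var w :> form C.
  by rewrite /update; case: eqP => [->|].
rewrite /subst msubst_gsub; first by rewrite -[RHS]gsub_id; apply: gsub_ext.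
by split=> // w; left.
Qed.

Lemma subst_closed phi x psi : fv phi = [::] -> fv psi = [::] ->
  subst phi x psi = phi.
Proof. by move=> e e'; rewrite subst_notin ?e //; exact: avoids_closed. Qed.

Lemma subst_subst_Var phi x y psi : fv psi = [::] ->
  y \notin fv phi -> y \notin bv phi ->
  subst (subst phi x (Var y)) y psi = subst phi x psi.
Proof.
move=> e yf yb; have av (q : form C) : avoids psi q by exact: avoids_closed.
rewrite (subst_gsub y (av _)) (subst_gsub x (av _)).
rewrite subst_gsub; last exact: avoids_Var.
rewrite gsub_comp; last by apply: nocap_update; exact: avoids_Var.
apply: gsub_ext => // w wp; have [->|wx] := eqVneq w x.
  by rewrite !updateE /= updateE.
rewrite !updateN //= updateN //; apply: contraNneq yf => <- //.
Qed.

Lemma wf_subst phi x psi : avoids psi phi -> wf phi -> wf psi ->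
  wf (subst phi x psi).
Proof.
move=> h wp ws; rewrite subst_gsub //; apply: wf_gsub => // w.
by rewrite /update; case: eqP.
Qed.

Lemma fv_subst_sub phi x psi z : avoids psi phi ->
  z \in fv (subst phi x psi) -> z \in fv psi \/ (z != x /\ z \in fv phi).
Proof.
move=> h; rewrite subst_gsub // => /fv_gsub_sub[[]//|[w wp]].
have [->|wx] := eqVneq w x; first by rewrite updateE; left.
by rewrite updateN // inE => /eqP ->; right.
Qed.

Lemma fv_subst_Var phi x y : x \in fv phi -> y \notin bv phi ->
  y \in fv (subst phi x (Var y)).
Proof.
move=> xp yb; rewrite subst_gsub; last exact: avoids_Var.
have : forall s : var -> form C, s x = Var y -> y \in fv (gsub Const s phi).
  elim: phi xp yb => //= [w|p IHp q IHq|p IHp q IHq|p IHp q IHq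
    |p IHp q IHq|w p IH].
  - by rewrite inE => /eqP -> _ s ->; rewrite inE.
  1-4: by rewrite !mem_cat negb_or => /orP[h|h] /andP[h1 h2] s e;
    rewrite mem_cat ?(IHp h h1) ?(IHq h h2) ?orbT.
  rewrite mem_filter inE negb_or => /andP[xw xp] /andP[yw yp] s e.
  by rewrite mem_filter yw IH // updateN.
by apply; rewrite updateE.
Qed.

Definition fresh_bound phi : nat := (foldr maxn 0 (fv phi ++ bv phi)).+1.

Lemma leq_foldr_maxn (l : seq nat) z : z \in l -> z <= foldr maxn 0 l.
Proof.
elim: l => //= a l IH; rewrite inE leq_max => /orP[/eqP ->|/IH ->].
  by rewrite leqnn.
by rewrite orbT.
Qed.

Lemma fresh_bound_fv phi z : z \in fv phi -> z < fresh_bound phi.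
Proof. by move=> h; rewrite ltnS leq_foldr_maxn // mem_cat h. Qed.

Lemma fresh_bound_bv phi z : z \in bv phi -> z < fresh_bound phi.
Proof. by move=> h; rewrite ltnS leq_foldr_maxn // mem_cat h orbT. Qed.

Lemma notin_fv_fresh phi z : fresh_bound phi <= z -> z \notin fv phi.
Proof. by move=> h; apply/negP => /fresh_bound_fv; rewrite ltnNge h. Qed.

Lemma notin_bv_fresh phi z : fresh_bound phi <= z -> z \notin bv phi.
Proof. by move=> h; apply/negP => /fresh_bound_bv; rewrite ltnNge h. Qed.

End Substitution.

(** * Derivability in Fm(C) *)

Section Deduction.
Variable C : signature.
Implicit Types (phi psi chi : form C) (X : form C -> Prop).

Lemma axiom_wf phi : is_axiom phi -> wf phi.
Proof. by elim=> // x p _ wp xp /=; rewrite xp. Qed.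

Lemma derives_wf X phi : (forall chi, X chi -> wf chi) ->
  derives X phi -> wf phi.
Proof.
move=> wX; elim=> {phi} [p /wX|p /axiom_wf|p /axiom_wf|p q _ _ _] //=.
by case/andP.
Qed.

Lemma derives_mono X Y phi : (forall chi, X chi -> Y chi) ->
  derives X phi -> derives Y phi.
Proof.
move=> XY; elim=> {phi} [p /XY|p|p|p q _ hp _ hq].
- exact: der_hyp.
- exact: der_axiom.
- exact: der_AN.
- exact: der_MP hp hq.
Qed.

Lemma derives_taut X l p : tautology p -> wf (pinst (nth Bot l) p) ->
  derives X (pinst (nth (@Bot C) l) p).
Proof. by move=> tp wp; apply/der_axiom/axiom_scheme => //; exact: sch_taut. Qed.

(** No restriction on [phi] is required, because necessitation never acts on a formula that depends
    on a hypothesis. *)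
Lemma deduction X phi psi : (forall chi, X chi -> wf chi) -> wf phi ->
  derives (fun chi => X chi \/ chi = phi) psi -> derives X (Imp phi psi).
Proof.
move=> wX wp.
have weak q : wf q -> derives X q -> derives X (Imp phi q).
  move=> wq dq; apply: der_MP dq _.
  apply: (@derives_taut X [:: q; phi] (PImp (PVar 0) (PImp (PVar 1) (PVar 0)))).
    by move=> v /=; case: (v 0); case: (v 1).
  by rewrite /= wp wq.
have wX' chi : X chi \/ chi = phi -> wf chi by case=> [/wX|->].
elim=> {psi} [q [Xq| ->]|q aq|q aq|q r dq hq dr hr].
- by apply: weak; [exact: wX | exact: der_hyp].
- apply: (@derives_taut X [:: phi] (PImp (PVar 0) (PVar 0))).
    by move=> v /=; case: (v 0).
  by rewrite /= wp.
- by apply: weak; [exact: axiom_wf | exact: der_axiom].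
- by apply: weak; [exact: axiom_wf aq | exact: der_AN].
have /= /andP[wq wr] := derives_wf wX' dr.
apply: der_MP hq _; apply: der_MP hr _.
apply: (@derives_taut X [:: phi; q; r]
  (PImp (PImp (PVar 0) (PImp (PVar 1) (PVar 2)))
    (PImp (PImp (PVar 0) (PVar 1)) (PImp (PVar 0) (PVar 2))))).
  by move=> v /=; case: (v 0); case: (v 1); case: (v 2).
by rewrite /= wp wq wr.
Qed.

(** There is no generalization rule, but axioms are closed under it. A boxed axiom is handled by
    boxing its generalization and moving the box inside. Modus ponens splits on whether [x] is free
    in the minor premise [q], since otherwise [All x q] is not a formula. *)
Lemma generalization X x phi : (forall chi, X chi -> wf chi) ->
  (forall chi, X chi -> x \notin fv chi) ->
  derives X phi -> x \in fv phi -> derives X (All x phi).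
Proof.
move=> wX nX; elim=> {phi} [q Xq|q aq|q aq|q r dq hq dr hr] xq.
- by move: (nX _ Xq); rewrite xq.
- by apply: der_axiom; exact: axiom_All.
- have h : derives X (Box (All x q)) by apply: der_AN; exact: axiom_All.
  apply: der_MP h _; apply/der_axiom/axiom_scheme; last exact: sch_Box_All.
  by move: xq => /= xq; rewrite /= xq (axiom_wf aq).
have /= /andP[wq wr] := derives_wf wX dr.
have /= xqr : x \in fv (Imp q r) by rewrite /= mem_cat xq orbT.
have [xq'|xq'] := boolP (x \in fv q).
  apply: der_MP (hq xq') _; apply: der_MP (hr xqr) _.
  apply/der_axiom/axiom_scheme; last exact: sch_All_Imp.
  by rewrite /= xqr wq wr xq' xq.
apply: der_MP dq _; apply: der_MP (hr xqr) _.
apply/der_axiom/axiom_scheme; last exact: sch_All_Imp_const.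
by rewrite /= xqr wq wr xq.
Qed.

Lemma generalization_fresh X x y phi : (forall chi, X chi -> wf chi) ->
  (forall chi, X chi -> y \notin fv chi) -> wf phi -> x \in fv phi ->
  y \notin fv phi -> y \notin bv phi ->
  derives X (subst phi x (Var y)) -> derives X (All x phi).
Proof.
move=> wX nX wp xp yf yb d.
have av : avoids (Var y : form C) phi by exact: avoids_Var.
have yin := fv_subst_Var xp yb.
have ws : wf (subst phi x (Var y)) by exact: wf_subst.
have h := generalization wX nX d yin.
apply: der_MP h _.
have a : derives X (Id (All y (subst phi x (Var y))) (All x phi)).
  apply/der_axiom/axiom_scheme; first by rewrite /= yin ws xp.
  apply/sch_alpha/alpha_sym/alpha_rename.
  by rewrite /= mem_filter (negbTE yf) andbF.
apply: der_MP a _; apply/der_axiom/axiom_scheme; last exact: sch_Id_Imp.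
by rewrite /= yin ws xp wp.
Qed.

Lemma derives_subst_fresh X x y phi : (forall chi, X chi -> wf chi) ->
  (forall chi, X chi -> y \notin fv chi) -> wf phi ->
  y \notin fv phi -> y \notin bv phi ->
  derives X (subst phi x (Var y)) -> derives X phi.
Proof.
move=> wX nX wp yf yb.
have [xp d|xp] := boolP (x \in fv phi); last first.
  by rewrite subst_notin //; exact: avoids_Var.
(* Generalize to [All x phi], then instantiate at [x] itself. *)
apply: der_MP (generalization_fresh wX nX wp xp yf yb d) _.
rewrite -{2}(subst_Var_id phi x); apply/der_axiom/axiom_scheme.
  by rewrite /= subst_Var_id wp xp.
exact: sch_All_inst.
Qed.

Definition shift N j : var -> form C :=
  fun n => if n < j then Var n else Var (N + n).

(** Variables are moved back one at a time, [j] counting those already restored. As the variables of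
    [phi] lie below [N], at stage [j.+1] the variable [N + j] is fresh, so [derives_subst_fresh]
    trades it for [j]. *)
Lemma derives_unshift N phi : wf phi -> fresh_bound phi <= N ->
  derives (fun=> False) (gsub Const (shift N 0) phi) ->
  derives (fun=> False) phi.
Proof.
move=> wp hN d.
have lt w : w \in fv phi -> w < N.
  by move=> /fresh_bound_fv h; exact: leq_trans h hN.
have nc j : nocap Const (shift N j) phi.
  split=> // w; rewrite /shift; case: ltnP => _; [by left|right].
  apply: avoids_Var; apply: notin_bv_fresh.
  exact: leq_trans hN (leq_addr _ _).
have bvs j : bv (gsub Const (shift N j) phi) = bv phi.
  by apply: bv_gsub => // w; rewrite /shift; case: ltnP.
have step j : j <= N ->
    derives (fun=> False) (gsub Const (shift N j) phi).
  elim: j => [//|j IH] jN.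
  have yb : N + j \notin bv (gsub Const (shift N j.+1) phi).
    rewrite bvs; apply: notin_bv_fresh; exact: leq_trans hN (leq_addr _ _).
  apply: (@derives_subst_fresh _ j (N + j)) => //.
  - by apply: wf_gsub => // w; rewrite /shift; case: ltnP.
  - apply/negP => /fv_gsub_sub[[]//|[w /lt wN]]; rewrite /shift.
    case: ltnP => wj; rewrite inE.
      by move/eqP => e; move: wN; rewrite -e ltnNge leq_addr.
    by rewrite eqn_add2l => /eqP e; move: wj; rewrite -e ltnn.
  - rewrite subst_gsub; last exact: avoids_Var.
    rewrite gsub_comp //.
    suff -> : gsub Const (fun w => gsub Const (update Var j (Var (N + j)))
      (shift N j.+1 w)) phi = gsub Const (shift N j) phi by exact/IH/ltnW.
    apply: gsub_ext => // w wf'; rewrite /shift ltnS.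
    case: (ltngtP w j) => [wj|wj|->] /=.
    + by rewrite updateN // neq_ltn wj.
    + rewrite updateN // neq_ltn; apply/orP; right.
      exact: leq_trans jN (leq_addr _ _).
    + by rewrite updateE.
have := step N (leqnn _); rewrite (_ : gsub _ _ _ = phi) //.
rewrite -[RHS]gsub_id; apply: gsub_ext => // w /lt wN.
by rewrite /shift wN.
Qed.

End Deduction.

(** * Henkin constants *)

Lemma inl_neq (A B : Type) (a b : A) : a <> b -> inl a <> inl b :> A + B.
Proof. by move=> ab [] /ab. Qed.

(* [FreeConst n] stands for the free variable x_n of Phi, and [WitConst x phi]
   is the Henkin witness for All x phi. *)
Inductive hconst (C : signature) : Type :=
| FreeConst of nat
| WitConst of var & form (@Signature (C + hconst C)%type
    (inl (ctop C)) (inl (cbot C)) (inl_neq (@ctop_neq_cbot C))).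

Definition hsig (C : signature) : signature :=
  @Signature (C + hconst C)%type (inl (ctop C)) (inl (cbot C))
    (inl_neq (@ctop_neq_cbot C)).

(** Plays the role of the stage at which a constant would enter in the usual chain of language
    extensions; here all stages are built at once by a nested inductive type. *)
Fixpoint rank (C : signature) (k : hconst C) {struct k} : nat :=
  match k with
  | FreeConst _ => 0
  | WitConst _ phi =>
    S ((fix frank (phi : form (hsig C)) : nat :=
      match phi with
      | Var _ => 0
      | Const (inl _) => 0
      | Const (inr d) => rank d
      | Neg p | Box p | All _ p => frank p
      | Imp p q | Or p q | And p q | Id p q => maxn (frank p) (frank q)
      end) phi)
  end.

(** In particular a witness never occurs in its own formula. *)
Lemma occ_rank (C : signature) (k : hconst C) x (phi : form (hsig C)) :
  occ (inr k : hsig C) phi -> rank k < rank (WitConst x phi).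
Proof.
rewrite [rank (WitConst _ _)]/= ltnS; elim: phi => //=.
1: by move=> [c|d] // [->].
1-4: by move=> p IHp q IHq; rewrite leq_max => -[/IHp ->|/IHq ->];
  rewrite ?orbT.
Qed.

(** The constants form an arbitrary type, so equality of formulas is decided classically and lists
    are handled with [List.In]. *)
Lemma filter_neq_In (T : Type) (a b : T) l :
  List.In b [seq c <- l | ~~ `[< c = a >]] <-> List.In b l /\ b <> a.
Proof.
elim: l => [|c l IH] /=; first by split=> [|[]].
case: asboolP => ca /=; rewrite IH.
  by split=> [[]|[[<-|?] ?]] //; split=> //; right.
by split=> [[<-|[]]|[[->|?] ?]]; auto.
Qed.

(** * Derivability with Henkin constants *)

Section Entailment.
Variable C : signature.
Local Notation H := (hsig C).
Local Notation K := (hconst C).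
Implicit Types (phi psi chi : form H) (v : K -> var) (A B : form H -> Prop).

Definition const_to_var v (c : H) : form C :=
  match c with inl c => Const c | inr k => Var (v k) end.

Definition unhenkin v phi : form C := gsub (const_to_var v) Var phi.

Lemma wf_unhenkin v phi : wf phi -> wf (unhenkin v phi).
Proof. by apply: wf_gsub => // -[]. Qed.

Lemma bv_unhenkin v phi : bv (unhenkin v phi) = bv phi.
Proof. by apply: bv_gsub => // -[]. Qed.

Lemma unhenkin_Imp v phi psi : unhenkin v (Imp phi psi) = Imp (unhenkin v phi) (unhenkin v psi).
Proof. by []. Qed.

Lemma unhenkin_Id v phi psi : unhenkin v (Id phi psi) = Id (unhenkin v phi) (unhenkin v psi).
Proof. by []. Qed.

Lemma unhenkin_Box v phi : unhenkin v (Box phi) = Box (unhenkin v phi).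
Proof. by []. Qed.

Lemma unhenkin_All v x phi : unhenkin v (All x phi) = All x (unhenkin v phi).
Proof.
congr All; apply: gsub_ext => // w _.
by rewrite /update; case: eqP => [->|].
Qed.

Lemma fv_cm_id v phi z : z \in fv phi -> z \in fv (unhenkin v phi).
Proof. by move=> h; exact: fv_gsub_id. Qed.

Lemma fv_unhenkin v phi z : z \in fv (unhenkin v phi) ->
  z \in fv phi \/ exists k, z = v k.
Proof.
case/fv_gsub_sub=> [[[c|k] _]|[w wp]] //; rewrite inE => /eqP ->; last by left.
by right; exists k.
Qed.

(** A variable standing for a constant must not be [x], or it would be replaced, nor be bound in
    [phi], or it would be captured; the two lower bounds on [v] exclude this. *)
Lemma unhenkin_subst v phi x psi : avoids psi phi ->
  (forall k, x < v k) -> (forall k, fresh_bound phi <= v k) ->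
  unhenkin v (subst phi x psi) = subst (unhenkin v phi) x (unhenkin v psi).
Proof.
move=> av xv pv.
rewrite !subst_gsub //; last first.
  move=> z; rewrite bv_unhenkin => zb; apply/negP => /fv_unhenkin[|[k e]].
    exact/negP/av.
  by have := notin_bv_fresh (pv k); rewrite -e zb.
rewrite /unhenkin !gsub_comp; first last.
- exact: nocap_update.
- split=> [[c|k]|w]; [by [] | | by left].
  by apply: avoids_Var; exact: notin_bv_fresh.
apply: gsub_ext => [[c|k] _|w _] //=.
  by rewrite updateN // neq_ltn xv orbT.
by rewrite /update; case: eqP.
Qed.

Lemma unhenkin_update v v' k phi : ~ occ (inr k : H) phi ->
  (forall j, j <> k -> v j = v' j) -> unhenkin v phi = unhenkin v' phi.
Proof.
move=> nk h; apply: gsub_ext => // -[c|j] //= oj; rewrite h // => jk.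
by apply: nk; rewrite -jk.
Qed.

Definition hyps v (l : seq (form H)) : form C -> Prop :=
  fun q => exists2 psi, List.In psi l & q = unhenkin v psi.

(* Henkin constants behave like sufficiently fresh variables: this turns
   derivability in the extended language into derivability in Fm(C). *)
Definition ent A phi : Prop :=
  exists2 l : seq (form H), (forall psi, List.In psi l -> A psi) &
  exists N, forall v, (forall k, N <= v k) -> derives (hyps v l) (unhenkin v phi).

Lemma hyps_sub v l l' : (forall psi, List.In psi l -> List.In psi l') ->
  forall q, hyps v l q -> hyps v l' q.
Proof. by move=> h chi [psi /h ? ->]; exists psi. Qed.

Lemma hyps_wf v l : (forall psi, List.In psi l -> wf psi) ->
  forall q, hyps v l q -> wf q.
Proof. by move=> h chi [psi /h w ->]; exact: wf_unhenkin. Qed.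

Lemma ent_hyp A phi : A phi -> ent A phi.
Proof.
move=> Ap; exists [:: phi]; first by move=> psi /= [<-|].
by exists 0 => v _; apply: der_hyp; exists phi => //; left.
Qed.

Lemma ent_mono A B phi : (forall psi, A psi -> B psi) -> ent A phi -> ent B phi.
Proof. by move=> AB [l Al h]; exists l => // psi /Al /AB. Qed.

Lemma ent_MP A phi psi : ent A phi -> ent A (Imp phi psi) -> ent A psi.
Proof.
move=> [l Al [N h]] [l' Al' [N' h']]; exists (l ++ l').
  by move=> chi /(@List.in_app_or _ l l') [/Al|/Al'].
exists (maxn N N') => v hv; apply: (@der_MP _ _ (unhenkin v phi)).
- apply: derives_mono (h v _) => [|k]; last first.
    by apply: leq_trans (hv k); rewrite leq_maxl.
  by apply: hyps_sub => chi ?; apply: List.in_or_app; left.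
- apply: derives_mono (h' v _) => [|k]; last first.
    by apply: leq_trans (hv k); rewrite leq_maxr.
  by apply: hyps_sub => chi ?; apply: List.in_or_app; right.
Qed.

(** The threshold [N] serves the schemes with a substitution or a freshness proviso, whose
    translations are known to be instances only for large enough variables. *)
Lemma ent_nec_scheme A phi N : wf phi ->
  (forall v, (forall k, N <= v k) -> scheme (unhenkin v phi)) -> ent A (Box phi).
Proof.
move=> wp h; exists [::] => //; exists N => v hv; apply: der_AN.
by apply: axiom_scheme; [exact: wf_unhenkin | exact: h].
Qed.

Lemma ent_T A phi : wf phi -> ent A (Box phi) -> ent A phi.
Proof.
move=> wp h; apply: ent_MP h _; exists [::] => //; exists 0 => v _.
by apply/der_axiom/axiom_scheme; [rewrite /= (wf_unhenkin v wp) | exact: sch_T].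
Qed.

Lemma ent_nec_taut A l p : tautology p -> wf (pinst (nth Bot l) p) ->
  ent A (Box (pinst (nth (@Bot H) l) p)).
Proof.
move=> tp wp; apply: (@ent_nec_scheme _ _ 0) => // v _.
have -> : unhenkin v (pinst (nth Bot l) p) = pinst (fun n => unhenkin v (nth Bot l n)) p.
  by rewrite /unhenkin; elim: p {tp wp} => //= [p ->|p -> q ->|p -> q ->|p -> q ->].
exact: sch_taut.
Qed.

Lemma ent_taut A l p : tautology p -> wf (pinst (nth Bot l) p) ->
  ent A (pinst (nth (@Bot H) l) p).
Proof. by move=> tp wp; apply: ent_T => //; exact: ent_nec_taut. Qed.

Lemma ent_deduction A phi psi : (forall chi, A chi -> wf chi) -> wf phi ->
  ent (fun chi => A chi \/ chi = phi) psi -> ent A (Imp phi psi).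
Proof.
move=> wA wp [l Al [N h]].
have Al' chi : List.In chi [seq c <- l | ~~ `[< c = phi >]] -> A chi.
  by move=> /filter_neq_In[/Al []].
exists [seq c <- l | ~~ `[< c = phi >]] => //; exists N => v hv.
apply: deduction; [|exact: wf_unhenkin|].
  by apply: hyps_wf => chi /Al' /wA.
apply: derives_mono (h v hv) => _ [chi cl ->].
have [->|ne] := pselect (chi = phi); first by right.
by left; exists chi => //; apply/filter_neq_In.
Qed.

Definition unary x phi : Prop :=
  [/\ wf phi, x \in fv phi & forall z, z \in fv phi -> z = x].

(** Since derivability holds for every large [v], the value of [v] at [k] may be redirected to a
    fresh variable [y]. The hypotheses and [phi] do not contain [k] and keep their translations, so
    generalizing over [y] is sound. *)
Lemma ent_generalization A x phi k : (forall chi, A chi -> wf chi) ->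
  unary x phi -> (forall chi, A chi -> ~ occ (inr k : H) chi) ->
  ~ occ (inr k : H) phi ->
  ent A (subst phi x (Const (inr k : H))) -> ent A (All x phi).
Proof.
move=> wA [wp xp _] nA np [l Al [N h]]; exists l => //.
exists (maxn N (maxn x.+1 (fresh_bound phi))) => v hv.
have /all_and3[hv1 hv2 hv3] j : [/\ N <= v j, x < v j & fresh_bound phi <= v j].
  by have := hv j; rewrite !geq_max => /and3P[].
(* [y] is chosen after [v], hence also beyond the variables that [v] puts into the hypotheses. *)
have [y [yN yx yp] yl] : exists2 y,
    [/\ N <= y, x < y & fresh_bound (unhenkin v phi) + fresh_bound phi <= y] &
    forall chi, List.In chi l -> fresh_bound (unhenkin v chi) <= y.
  elim: l {Al h} => [|a l [y [h1 h2 h3] IH]].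
    exists (N + x.+1 + (fresh_bound (unhenkin v phi) + fresh_bound phi)) => //; split.
    + by rewrite -addnA leq_addr.
    + by apply: leq_trans (leq_addr _ _); rewrite leq_addl.
    + by rewrite leq_addl.
  exists (y + fresh_bound (unhenkin v a)).
    by split; apply: leq_trans (leq_addr _ _).
  move=> chi /= [<-|/IH hc]; first by rewrite leq_addl.
  exact: leq_trans hc (leq_addr _ _).
pose v' j := if `[< j = k >] then y else v j.
have v'E j : j <> k -> v' j = v j by rewrite /v'; case: asboolP.
have v'k : v' k = y by rewrite /v'; case: asboolP.
have cmE chi : ~ occ (inr k : H) chi -> unhenkin v' chi = unhenkin v chi.
  by move=> nc; exact: unhenkin_update v'E.
have yp1 : fresh_bound (unhenkin v phi) <= y := leq_trans (leq_addr _ _) yp.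
have yp2 : fresh_bound phi <= y := leq_trans (leq_addl _ _) yp.
have ge (P : nat -> Prop) : P y -> (forall j, P (v j)) -> forall j, P (v' j).
  by move=> Py Pv j; rewrite /v'; case: asboolP.
have hX q : hyps v l q -> wf q by apply: hyps_wf => ? /Al /wA.
rewrite unhenkin_All; apply: (@generalization_fresh _ _ x y) => //.
- by move=> chi [psi pl ->]; apply: notin_fv_fresh; exact: yl.
- exact: wf_unhenkin.
- exact: fv_cm_id.
- exact: notin_fv_fresh.
- exact: notin_bv_fresh.
have := h v' (ge (leq N) yN hv1); rewrite unhenkin_subst; first last.
- exact: (ge (leq _)).
- exact: (ge (leq _)).
- exact: avoids_closed.
rewrite [unhenkin v' (Const _)]/= /unhenkin /= v'k -/(unhenkin v' phi) cmE // => d.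
apply: derives_mono d => _ [chi cl ->]; exists chi => //.
by rewrite cmE //; exact/nA/Al.
Qed.

(** * Consistency and a single witness axiom *)

Definition econs A : Prop := ~ ent A Bot.

Definition wit_axiom x phi : form H :=
  Imp (subst phi x (Const (inr (WitConst x phi) : H))) (All x phi).

Lemma sentence_subst_fv x phi psi : wf phi -> (forall z, z \in fv phi -> z = x) ->
  sentence psi -> sentence (subst phi x psi).
Proof.
move=> wp fp [ws fs]; have av : avoids psi phi by exact: avoids_closed.
split; first exact: wf_subst.
case e: (fv _) => [//|z r]; have : z \in fv (subst phi x psi).
  by rewrite e inE eqxx.
move/(fv_subst_sub av) => [|[zx /fp e']]; first by rewrite fs.
by rewrite e' eqxx in zx.
Qed.

Lemma sentence_subst x phi psi : unary x phi -> sentence psi ->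
  sentence (subst phi x psi).
Proof. by move=> [wp _ fp]; exact: sentence_subst_fv. Qed.

Lemma sentence_All x phi : unary x phi -> sentence (All x phi).
Proof.
move=> [wp xp fp]; split; first by rewrite /= wp xp.
rewrite /=; apply/eqP; rewrite -(negbK (_ == _)) -has_filter; apply/hasPn.
by move=> z /fp ->; rewrite eqxx.
Qed.

Lemma sentence_wit_axiom x phi : unary x phi -> sentence (wit_axiom x phi).
Proof.
move=> u; have [|w f] := @sentence_subst _ _ (Const (inr (WitConst x phi) : H)) u.
  by [].
have [w' f'] := sentence_All u.
by split; [apply/andP | rewrite /= f; exact: f'].
Qed.

(** Refuting the witness axiom proves its antecedent. The witness is fresh, so this generalizes to
    [All x phi], the consequent, and with it the refuted axiom is derivable. *)
Lemma econs_wit_axiom A x phi : (forall chi, A chi -> wf chi) -> unary x phi ->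
  (forall chi, A chi -> ~ occ (inr (WitConst x phi) : H) chi) ->
  econs A -> econs (fun chi => A chi \/ chi = wit_axiom x phi).
Proof.
move=> wA u nA cA eB; apply: cA.
have [wh _] := sentence_wit_axiom u; move/andP: (wh) => [w1 w2].
have d := ent_deduction wA wh eB.
have e1 : ent A (subst phi x (Const (inr (WitConst x phi) : H))).
  apply: ent_MP d _.
  apply: (@ent_taut _ [:: subst phi x (Const (inr (WitConst x phi) : H));
    All x phi] (PImp (PImp (PImp (PVar 0) (PVar 1)) PBot) (PVar 0))).
    by move=> v /=; case: (v 0); case: (v 1).
  by apply/andP; split; first exact/andP.
have e2 : ent A (All x phi).
  apply: ent_generalization e1 => // o.
  by have := occ_rank x o; rewrite ltnn.
apply: (ent_MP _ d); apply: ent_MP e2 _.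
apply: (@ent_taut _ [:: subst phi x (Const (inr (WitConst x phi) : H));
    All x phi] (PImp (PVar 1) (PImp (PVar 0) (PVar 1)))).
  by move=> v /=; case: (v 0); case: (v 1).
by apply/andP; split=> //; apply/andP; split.
Qed.

Lemma occ_wit_axiom (k : K) x phi : occ (inr k : H) (wit_axiom x phi) ->
  rank k < rank (WitConst x phi) \/ k = WitConst x phi.
Proof.
case=> [|/(occ_rank x)]; last by left.
rewrite subst_gsub //; case/occ_gsub=> [[c oc /= e]|[w]].
  by subst c; left; exact: occ_rank oc.
by rewrite /update; case: eqP => //= _ [e]; right.
Qed.

Lemma exists_max_rank (l : seq (var * form H)) : l <> [::] ->
  exists2 p, List.In p l & forall q, List.In q l ->
    rank (WitConst q.1 q.2) <= rank (WitConst p.1 p.2).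
Proof.
elim: l => // a [|b l] IH _; first by exists a; [left | move=> q /= [->|]].
have [//|p pl hp] := IH.
case: (leqP (rank (WitConst a.1 a.2)) (rank (WitConst p.1 p.2))) => h.
  by exists p; [right | move=> q [<-|/hp]].
exists a; [by left|]; move=> q [<-//|/hp h'].
exact: leq_trans h' (ltnW h).
Qed.

(** * Adding all witness axioms consistently *)

Section Witnesses.
Variable A : form H -> Prop.
Hypothesis wA : forall chi, A chi -> wf chi.
Hypothesis nA : forall chi x phi, A chi -> ~ occ (inr (WitConst x phi) : H) chi.
Hypothesis cA : econs A.

(* Witnesses are discharged in order of decreasing rank, so that the one being
   discharged occurs in no remaining axiom. *)
Lemma econs_wit_axiom_list (l : seq (var * form H)) :
  (forall p, List.In p l -> unary p.1 p.2) ->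
  econs (fun chi => A chi \/ exists2 p, List.In p l & chi = wit_axiom p.1 p.2).
Proof.
have [n] := ubnP (size l); elim: n l => // n IH l; rewrite ltnS => sl ul.
have [->|nl] := pselect (l = [::]).
  by move=> e; apply: cA; apply: ent_mono e => chi [|[]].
have [p pl hp] := exists_max_rank nl.
pose l' := [seq q <- l | ~~ `[< q = p >]].
have ul' q : List.In q l' -> unary q.1 q.2 by move/filter_neq_In=> [/ul].
have sl' : size l' < n.
  apply: leq_trans sl; rewrite /l' size_filter.
  elim: (l) pl => //= a r IHr [->|/IHr h].
    by rewrite asboolT //= add0n ltnS count_size.
  by rewrite -addn1 -(addn1 (size r)) addnAC; case: asboolP => _ /=;
    rewrite ?add0n ?add1n ?addn1 ?ltnS // ltnW.
have c' := IH l' sl' ul' => e.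
apply: (@econs_wit_axiom _ p.1 p.2 _ (ul p pl) _ c').
- by move=> chi [/wA //|[q /ul' /sentence_wit_axiom [? _] ->]].
- move=> chi [/nA h /h //|[q /filter_neq_In[ql qp] ->] /occ_wit_axiom[|[e1 e2]]].
    by rewrite ltnNge hp.
  by apply: qp; case: q p e1 e2 {hp pl l' ul' sl' c' e ql} => ? ? [? ?] /= -> ->.
apply: ent_mono e => chi [?|[q ql ->]]; first by left; left.
have [->|qp] := pselect (q = p); first by right.
by left; right; exists q => //; apply/filter_neq_In.
Qed.

Lemma econs_wit_axiom_all : econs (fun chi =>
  A chi \/ exists x phi, unary x phi /\ chi = wit_axiom x phi).
Proof.
case=> L AL e.
have [l ul hl] : exists2 l : seq (var * form H),
    (forall p, List.In p l -> unary p.1 p.2) &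
    forall chi, List.In chi L ->
      A chi \/ exists2 p, List.In p l & chi = wit_axiom p.1 p.2.
  elim: L AL {e} => [|a L IH] AL; first by exists [::].
  have [|l ul hl] := IH; first by move=> psi h; apply: AL; right.
  case: (AL a (or_introl erefl)) => [Aa|[x [phi [u ea]]]].
    by exists l => // chi /= [<-|/hl]; [left|].
  exists ((x, phi) :: l) => [p /= [<-|/ul]|chi /= [<-|/hl]] //.
    by right; exists (x, phi) => //; left.
  by case=> [?|[p pl ->]]; [left | right; exists p => //; right].
by apply: (econs_wit_axiom_list ul); exists L.
Qed.

End Witnesses.

(** * Maximal consistent extension *)

Section Lindenbaum.
Variable A : form H -> Prop.
Hypothesis sA : forall chi, A chi -> sentence chi.
Hypothesis cA : econs A.

Lemma lindenbaum : exists T : form H -> Prop,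
  [/\ forall chi, A chi -> T chi, forall chi, T chi -> sentence chi, econs T &
    forall phi, sentence phi -> ~ T phi -> ent T (Neg phi)].
Proof.
(* Zorn is applied to the part added to [A] rather than to the whole theory, so that the empty
   chain, whose union is empty, causes no exception. *)
pose U (B : form H -> Prop) := fun chi => A chi \/ B chi.
pose P (B : set (form H)) := (forall chi, B chi -> sentence chi) /\ econs (U B).
have [|B [[sB cB] mB]] := @Zorn_bigcup _ P.
  move=> F FP totF; split=> [chi [X FX]|[l Ul e]]; first exact: (FP _ FX).1.
  (* A derivation uses finitely many hypotheses, so one member of the chain holds all that lie
     outside [A]; [set0] stands in when there are none. *)
  have [X XP Xl] : exists2 X, X = set0 \/ F X &
      forall psi, List.In psi l -> U X psi.
    elim: l Ul {e} => [|a l IH] Ul; first by exists set0; [left|].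
    have [|X FX Xl] := IH; first by move=> psi h; apply: Ul; right.
    case: (Ul a (or_introl erefl)) => [Aa|[Y FY Ya]].
      by exists X => // psi /= [<-|/Xl]; [left|].
    case: FX => [X0|FX].
      exists Y; [by right|move=> psi /= [<-|/Xl]]; [by right|].
      by rewrite X0 => -[]; [left|].
    case: (totF _ _ FX FY) => XY.
      exists Y; [by right|move=> psi /= [<-|/Xl]]; [by right|].
      by case=> [?|/XY ?]; [left|right].
    exists X; [by right|move=> psi /= [<-|/Xl //]].
    by right; exact: XY.
  case: XP => [X0|/FP[_]]; last by apply; exists l.
  by apply: cA; exists l => // psi /Xl; rewrite X0 => -[].
have sU chi : U B chi -> sentence chi by case=> [/sA|/sB].
exists (U B); split=> // [chi|phi sp np]; first by left.
have wU chi : U B chi -> wf chi by case/sU.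
have [e|ne] := pselect (ent (fun chi => U B chi \/ chi = phi) Bot).
  have [wp _] := sp; have d := ent_deduction wU wp e.
  apply: ent_MP d _.
  apply: (@ent_taut _ [:: phi] (PImp (PImp (PVar 0) PBot) (PNeg (PVar 0)))).
    by move=> v /=; case: (v 0).
  by rewrite /= wp.
case: (mB (fun chi => B chi \/ chi = phi)).
  split=> [|h]; first by move=> chi; left.
  by apply: np; right; apply: h; right.
split=> [chi [/sB|->]|] // e; apply: ne; apply: ent_mono e.
by move=> chi [?|[?|?]]; [left; left | left; right | right].
Qed.

End Lindenbaum.

(** * Free variables of Phi turned into constants *)

Section Closing.
Variable Phi : form C -> Prop.
Hypothesis Phi_Fm : forall p, Phi p -> wf p.
Hypothesis Phi_consistent : consistent Phi.

Definition emb (s : var -> form H) (p : form C) : form H :=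
  gsub (fun c => Const (inl c : H)) s p.

Definition free_const (n : var) : form H := Const (inr (FreeConst C n) : H).

Definition closing : form H -> Prop :=
  fun chi => exists2 p, Phi p & chi = emb free_const p.

Lemma sentence_emb s p : (forall n, sentence (s n)) -> wf p ->
  sentence (emb s p).
Proof.
move=> hs wp; split; first by apply: wf_gsub => // n; case: (hs n).
case e: (fv _) => [//|z r]; have : z \in fv (emb s p) by rewrite e inE eqxx.
by case/fv_gsub_sub=> [[]//|[w _]]; have [_ ->] := hs w.
Qed.

Lemma closing_sentence chi : closing chi -> sentence chi.
Proof. by move=> [p /Phi_Fm wp ->]; exact: sentence_emb. Qed.

Lemma closing_wit chi x phi : closing chi ->
  ~ occ (inr (WitConst x phi) : H) chi.
Proof. by move=> [p _ ->] /occ_gsub[[]|[]]. Qed.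

Lemma derives_imps (X : form C -> Prop) l r : (forall p, X p -> wf p) ->
  (forall p, List.In p l -> wf p) ->
  derives (fun p => X p \/ List.In p l) r -> derives X (foldr (@Imp C) r l).
Proof.
elim: l X => [|a l IH] X wX wl /=; first by apply: derives_mono => p [].
have wa : wf a by apply: wl; left.
move=> d; apply: deduction => //; apply: IH.
- by move=> p [/wX|->].
- by move=> p h; apply: wl; right.
by apply: derives_mono d => p [?|[<-|?]]; [left; left|left; right|right].
Qed.

Lemma econs_closing : econs closing.
Proof.
case=> L TL [N h].
have [l lPhi eL] : exists2 l, (forall p, List.In p l -> Phi p) &
    L = map (emb free_const) l.
  elim: L TL {h} => [|a L IH] TL; first by exists [::].
  have [|l lP ->] := IH; first by move=> psi hp; apply: TL; right.
  have [p Pp ->] := TL a (or_introl erefl); exists (p :: l) => //.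
  by move=> q [<-|/lP].
(* The hypotheses are packed into one implication because [derives_unshift] works only without
   hypotheses. *)
pose F := foldr (@Imp C) Bot l.
have wF : wf F.
  rewrite /F; elim: (l) lPhi => //= a r IH lP; rewrite Phi_Fm ?IH //.
    by move=> p hp; apply: lP; right.
  by apply: lP; left.
pose M := maxn N (fresh_bound F).
(* With this choice, closing a formula and translating it back shifts its free variables by [M]. *)
pose v (k : K) := if k is FreeConst n then M + n else M.
have vM k : M <= v k by case: k => //= n; rewrite leq_addr.
have hv k : N <= v k by apply: leq_trans (vM k); rewrite leq_maxl.
have cmE p : unhenkin v (emb free_const p) = gsub Const (shift C M 0) p.
  by rewrite /unhenkin /emb gsub_comp; [apply: gsub_ext | split=> // w; right].
have dF : derives (fun=> False) (gsub Const (shift C M 0) F).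
  have -> : gsub Const (shift C M 0) F =
      foldr (@Imp C) Bot (map (unhenkin v) L).
    by rewrite eL /F; elim: (l) => //= a r ->; rewrite cmE.
  apply: derives_imps => // [_ /List.in_map_iff[chi [<- /TL]]|].
    by move=> /closing_sentence[wc _]; exact: wf_unhenkin.
  apply: derives_mono (h v hv) => chi [psi pL ->]; right.
  exact: (List.in_map (unhenkin v) L psi pL).
have dF' := derives_unshift wF (leq_maxr _ _) dF.
apply: Phi_consistent.
have : derives Phi F by apply: derives_mono dF'.
rewrite /F; elim: (l) lPhi => //= a r IH lP d; apply: IH.
  by move=> p hp; apply: lP; right.
by apply: der_MP d; apply: der_hyp; apply: lP; left.
Qed.

Lemma henkin_theory : exists T : form H -> Prop,
  [/\ forall p, Phi p -> T (emb free_const p), forall chi, T chi -> sentence chi,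
    forall x phi, unary x phi -> T (wit_axiom x phi), econs T &
    forall phi, sentence phi -> ~ T phi -> ent T (Neg phi)].
Proof.
have wc chi : closing chi -> wf chi by case/closing_sentence.
have [|T [AT sT cT mT]] := lindenbaum _ (econs_wit_axiom_all wc closing_wit econs_closing).
  by move=> chi [/closing_sentence|[x [phi [/sentence_wit_axiom ? ->]]]].
exists T; split=> // [p Pp|x phi u]; apply: AT; first by left; exists p.
by right; exists x, phi.
Qed.

End Closing.
End Entailment.

(** * The canonical model *)

Section CanonicalModel.
Variable C : signature.
Local Notation H := (hsig C).
Local Notation K := (hconst C).
Implicit Types (phi psi chi a b c d : form H) (v : K -> var).

Variable T : form H -> Prop.
Hypothesis sT : forall chi, T chi -> sentence chi.
Hypothesis hT : forall x phi, unary x phi -> T (wit_axiom x phi).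
Hypothesis cT : econs T.
Hypothesis mT : forall phi, sentence phi -> ~ T phi -> ent T (Neg phi).

(** * Necessary laws of the theory *)

Lemma sentence_Neg a : sentence a -> sentence (Neg a).
Proof. by []. Qed.

Lemma sentence_Box a : sentence a -> sentence (Box a).
Proof. by []. Qed.

Lemma sentence_Imp a b : sentence a -> sentence b -> sentence (Imp a b).
Proof. by move=> [wa fa] [wb fb]; split; rewrite /= ?wa ?wb ?fa ?fb. Qed.

Lemma sentence_Or a b : sentence a -> sentence b -> sentence (Or a b).
Proof. exact: sentence_Imp. Qed.

Lemma sentence_And a b : sentence a -> sentence b -> sentence (And a b).
Proof. exact: sentence_Imp. Qed.

Lemma sentence_Id a b : sentence a -> sentence b -> sentence (Id a b).
Proof. exact: sentence_Imp. Qed.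

Lemma sentence_Imp_inv a b : sentence (Imp a b) -> sentence a /\ sentence b.
Proof.
move=> [/= /andP[wa wb] f]; split; split=> //.
  by case: (fv a) f.
by case: (fv a) f.
Qed.

Lemma sentence_Bot : sentence (@Bot H). Proof. by []. Qed.
Lemma sentence_Top : sentence (@Top H). Proof. by []. Qed.

Hint Resolve sentence_Neg sentence_Box sentence_Imp sentence_Or sentence_And
  sentence_Id sentence_Bot sentence_Top sentence_subst sentence_All : sent.
Local Ltac sent := solve [auto 10 with sent].

Lemma sentence_pinst l p : (forall n, sentence (nth Bot l n)) ->
  sentence (pinst (nth (@Bot H) l) p).
Proof. by move=> h; elim: p => /= *; auto with sent. Qed.

Lemma T_ent a : sentence a -> ent T a -> T a.
Proof.
move=> sa ea; apply: contrapT => nTa; apply: cT.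
apply: ent_MP (mT sa nTa) _; apply: ent_MP ea _.
apply: (@ent_taut _ _ [:: a] (PImp (PVar 0) (PImp (PNeg (PVar 0)) PBot))).
  by move=> v /=; case: (v 0).
by case: sa => wa _; rewrite /= wa.
Qed.

Lemma T_Bot : ~ T Bot.
Proof. by move=> h; apply: cT; exact: ent_hyp. Qed.

Lemma T_MP a b : T a -> T (Imp a b) -> T b.
Proof.
move=> Ta Tab; have [_ sb] := sentence_Imp_inv (sT Tab).
by apply: T_ent => //; apply: ent_MP (ent_hyp Ta) (ent_hyp Tab).
Qed.

Lemma T_Box a : T (Box a) -> T a.
Proof.
move=> h; have [wa fa] := sT h; apply: T_ent => //; apply: ent_T => //.
exact: ent_hyp.
Qed.

Lemma nec_scheme N a : sentence a ->
  (forall v, (forall k, N <= v k) -> scheme (unhenkin v a)) -> T (Box a).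
Proof.
move=> sa h; apply: T_ent; first sent.
by case: sa => wa _; exact: ent_nec_scheme h.
Qed.

Lemma nec_K a b : T (Box (Imp a b)) -> T (Box a) -> T (Box b).
Proof.
move=> hab ha; have [sa sb] := sentence_Imp_inv (sT hab).
apply: T_MP ha _; apply: T_MP hab _; apply: T_Box.
by apply: (@nec_scheme 0) => [|v _]; [sent | exact: sch_K].
Qed.

Lemma nec_pinst l p : (forall n, sentence (nth Bot l n)) -> tautology p ->
  T (Box (pinst (nth Bot l) p)).
Proof.
move=> hl tp; have [w f] := sentence_pinst p hl.
by apply: T_ent; [split | exact: ent_nec_taut].
Qed.

Lemma nec_Id_refl a : sentence a -> T (Box (Id a a)).
Proof.
move=> sa; apply: (@nec_scheme 0) => [|v _]; first sent.
exact/sch_alpha/alpha_refl.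
Qed.

Lemma nec_Id_Imp a b : sentence a -> sentence b ->
  T (Box (Imp (Id a b) (Imp a b))).
Proof.
by move=> sa sb; apply: (@nec_scheme 0) => [|v _]; [sent | exact: sch_Id_Imp].
Qed.

Definition bound x phi : nat := x.+1 + fresh_bound phi.

Lemma unhenkin_subst_bound v x phi psi : avoids psi phi ->
  (forall k, bound x phi <= v k) ->
  unhenkin v (subst phi x psi) = subst (unhenkin v phi) x (unhenkin v psi).
Proof.
move=> av hv; apply: unhenkin_subst => // k; apply: leq_trans (hv k).
  exact: leq_addr.
exact: leq_addl.
Qed.

Lemma sentence_avoids a phi : sentence a -> avoids a phi.
Proof. by move=> [_ fa]; exact: avoids_closed. Qed.

Lemma nec_Id_subst x phi a b : unary x phi -> sentence a -> sentence b ->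
  T (Box (Imp (Id a b) (Id (subst phi x a) (subst phi x b)))).
Proof.
move=> u sa sb; apply: (@nec_scheme (bound x phi)) => [|v hv]; first sent.
rewrite unhenkin_Imp !unhenkin_Id !unhenkin_subst_bound //; try exact: sentence_avoids.
by apply: sch_Id_subst; case: u => _ xp _; exact: fv_cm_id.
Qed.

Lemma nec_All_inst x phi a : unary x phi -> sentence a ->
  T (Box (Imp (All x phi) (subst phi x a))).
Proof.
move=> u sa; apply: (@nec_scheme (bound x phi)) => [|v hv]; first sent.
rewrite unhenkin_Imp unhenkin_All unhenkin_subst_bound //; last exact: sentence_avoids.
exact: sch_All_inst.
Qed.

Lemma unary_Imp x phi psi : unary x phi -> unary x psi -> unary x (Imp phi psi).
Proof.
move=> [wp xp fp] [wq xq fq]; split=> [|| z] /=; first by rewrite wp wq.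
  by rewrite mem_cat xp.
by rewrite mem_cat => /orP[/fp|/fq].
Qed.

Lemma unary_Imp_sentence x a phi : sentence a -> unary x phi ->
  unary x (Imp a phi).
Proof. by move=> [wa fa] [wp xp fp]; split; rewrite /= ?fa ?wa ?wp. Qed.

Lemma unary_Box x phi : unary x phi -> unary x (Box phi).
Proof. by []. Qed.

Lemma unary_Id x phi psi : unary x phi -> unary x psi -> unary x (Id phi psi).
Proof. exact: unary_Imp. Qed.

Hint Resolve unary_Imp unary_Box unary_Id unary_Imp_sentence : sent.

Lemma nec_All_Id x phi psi : unary x phi -> unary x psi ->
  T (Box (Imp (All x (Id phi psi)) (Id (All x phi) (All x psi)))).
Proof.
move=> u u'; apply: (@nec_scheme 0) => [|v _]; first sent.
rewrite !(unhenkin_Imp, unhenkin_Id, unhenkin_All); exact: sch_All_Id.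
Qed.

Lemma nec_All_Imp_const x a phi : sentence a -> unary x phi ->
  T (Box (Imp (All x (Imp a phi)) (Imp a (All x phi)))).
Proof.
move=> sa u; apply: (@nec_scheme x.+1) => [|v hv]; first sent.
rewrite !(unhenkin_Imp, unhenkin_All); apply: sch_All_Imp_const; apply/negP => /fv_unhenkin[|[k e]].
  by case: sa => _ ->.
by move: (hv k); rewrite -e ltnn.
Qed.

Lemma nec_Barcan x phi : unary x phi ->
  T (Box (Imp (All x (Box phi)) (Box (All x phi)))).
Proof.
move=> u; apply: (@nec_scheme 0) => [|v _]; first sent.
rewrite !(unhenkin_Imp, unhenkin_Box, unhenkin_All); exact: sch_Barcan.
Qed.

Lemma unary_rename x y phi : unary x phi -> y \notin bv phi ->
  unary y (subst phi x (Var y)).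
Proof.
move=> [wp xp fp] yb; have av : avoids (Var y : form H) phi by exact: avoids_Var.
split; [exact: wf_subst | exact: fv_subst_Var |].
move=> z /(fv_subst_sub av)[|[zx /fp e]]; first by rewrite inE => /eqP.
by rewrite e eqxx in zx.
Qed.

Lemma T_rename x y phi : unary x phi -> y \notin fv phi -> y \notin bv phi ->
  T (Id (All x phi) (All y (subst phi x (Var y)))).
Proof.
move=> u yf yb; have u' := unary_rename u yb; apply: T_Box.
apply: (@nec_scheme (y.+1 + bound x phi)) => [|v hv]; first sent.
rewrite unhenkin_Id !unhenkin_All unhenkin_subst_bound; first last.
- by move=> k; apply: leq_trans (hv k); rewrite leq_addl.
- exact: avoids_Var.
apply/sch_alpha/alpha_rename; rewrite /= mem_filter negb_and; apply/orP; right.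
apply/negP => /fv_unhenkin[|[k e]]; first exact/negP.
by have := leq_trans (leq_addr _ _) (hv k); rewrite -e ltnn.
Qed.

(** An omega rule: the witness is itself a sentence, so the antecedent of the witness axiom is among
    the instances. *)
Lemma T_All x phi : unary x phi -> (forall a, sentence a -> T (subst phi x a)) ->
  T (All x phi).
Proof. by move=> u h; apply: T_MP (hT u); exact: h. Qed.

Lemma T_Id_T a b : T (Id a b) -> T a -> T b.
Proof.
move=> e Ta; have [sa sb] := sentence_Imp_inv (sT e : sentence (Imp a b)).
by apply: T_MP Ta _; apply: T_MP e _; apply: T_Box; exact: nec_Id_Imp.
Qed.

Lemma T_Id_subst x phi a b : unary x phi -> T (Id a b) ->
  T (Id (subst phi x a) (subst phi x b)).
Proof.
move=> u e; have [sa sb] := sentence_Imp_inv (sT e : sentence (Imp a b)).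
by apply: T_MP e _; apply: T_Box; exact: nec_Id_subst.
Qed.

Lemma T_Id_refl a : sentence a -> T (Id a a).
Proof. by move=> sa; apply: T_Box; exact: nec_Id_refl. Qed.

Lemma subst_sentence a x b : sentence a -> sentence b -> subst a x b = a.
Proof. by move=> [_ fa] [_ fb]; exact: subst_closed. Qed.

Lemma unary_Var x : unary x (Var x : form H).
Proof. by split=> // [|z]; rewrite inE // => /eqP. Qed.

Lemma unary_Id_l x phi a : sentence a -> unary x phi -> unary x (Id phi a).
Proof. by move=> [wa fa] [wp xp fp]; split; rewrite /= ?fa ?cats0 ?wa ?wp. Qed.

Lemma unary_Id_r x phi a : sentence a -> unary x phi -> unary x (Id a phi).
Proof. exact: unary_Imp_sentence. Qed.

Lemma T_Id_sym a b : T (Id a b) -> T (Id b a).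
Proof.
move=> e; have [sa sb] := sentence_Imp_inv (sT e : sentence (Imp a b)).
(* Leibniz: replacing [a] by [b] in this formula identifies [Id a a] with [Id b a]. *)
have u : unary 0 (Id (Var 0) a) by exact: unary_Id_l (unary_Var 0).
have := T_Id_subst u e; rewrite /subst /= -!/(subst a 0 _) !updateE.
by rewrite !subst_sentence // => h; apply: T_Id_T h _; exact: T_Id_refl.
Qed.

Lemma T_Id_trans a b c : T (Id a b) -> T (Id b c) -> T (Id a c).
Proof.
move=> e e'; have [sa sb] := sentence_Imp_inv (sT e : sentence (Imp a b)).
have [_ sc] := sentence_Imp_inv (sT e' : sentence (Imp b c)).
have u : unary 0 (Id a (Var 0)) by exact: unary_Id_r (unary_Var 0).
have := T_Id_subst u e'; rewrite /subst /= -!/(subst a 0 _) !updateE.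
by rewrite !subst_sentence // => h; apply: T_Id_T h _.
Qed.

Definition binary (op : form H -> form H -> form H) : Prop :=
  [\/ op = @Imp H, op = @Or H, op = @And H | op = @Id H].

Lemma T_Id_binary op a a' b b' : binary op -> T (Id a a') -> T (Id b b') ->
  T (Id (op a b) (op a' b')).
Proof.
move=> bop e e'; have [sa sa'] := sentence_Imp_inv (sT e : sentence (Imp a a')).
have [sb sb'] := sentence_Imp_inv (sT e' : sentence (Imp b b')).
have ul : unary 0 (op (Var 0) b).
  by case: bop => ->; exact: unary_Id_l (unary_Var 0).
have ur : unary 0 (op a' (Var 0)).
  by case: bop => ->; exact: unary_Id_r (unary_Var 0).
apply: (@T_Id_trans _ (op a' b)).
- have := T_Id_subst ul e; case: bop => -> {ul ur};
  by rewrite /subst /= -!/(subst b 0 _) !updateE !subst_sentence.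
- have := T_Id_subst ur e'; case: bop => -> {ul ur};
  by rewrite /subst /= -!/(subst a' 0 _) !updateE !subst_sentence.
Qed.

Lemma T_Id_Neg a a' : T (Id a a') -> T (Id (Neg a) (Neg a')).
Proof.
have u : unary 0 (Neg (Var 0) : form H) by exact: unary_Var.
by move=> e; have := T_Id_subst u e; rewrite /subst /= !updateE.
Qed.

Lemma T_Id_Box a a' : T (Id a a') -> T (Id (Box a) (Box a')).
Proof.
have u : unary 0 (Box (Var 0) : form H) by exact: unary_Var.
by move=> e; have := T_Id_subst u e; rewrite /subst /= !updateE.
Qed.

(** Classes are taken for identity, not for strict equivalence, since an identity must be true
    exactly when both sides denote the same element. *)
Definition quot : Type :=
  {P : form H -> Prop | exists2 a, sentence a & P = (fun b => T (Id a b))}.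

Lemma quot_closeP a : exists2 b, sentence b &
  (fun c => T (Id (if `[< sentence a >] then a else Bot) c)) =
  (fun c => T (Id b c)).
Proof.
by exists (if `[< sentence a >] then a else Bot) => //; case: asboolP.
Qed.

(* Formulas that are not sentences are sent to the class of Bot. *)
Definition cls a : quot := exist _ _ (quot_closeP a).

Lemma quot_inh (m : quot) :
  exists a, sentence a /\ sval m = (fun b => T (Id a b)).
Proof. by case: (svalP m) => a; exists a. Qed.

Definition rp (m : quot) : form H := projT1 (cid (quot_inh m)).

Lemma rp_sentence m : sentence (rp m).
Proof. by rewrite /rp; case: cid => a [] /=. Qed.

Lemma cls_eq a b : sentence a -> sentence b -> cls a = cls b <-> T (Id a b).
Proof.
move=> sa sb; split=> [/(congr1 sval) /= |e].
  rewrite !asboolT // => /(congr1 (fun P => P b)) => ->; exact: T_Id_refl.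
apply: eq_exist => /=; rewrite !asboolT //; apply/funext => c; apply/propext.
split=> h; last exact: T_Id_trans e h.
exact: T_Id_trans (T_Id_sym e) h.
Qed.

Lemma rpK m : cls (rp m) = m.
Proof.
case: m => P hP; apply: eq_exist => /=; rewrite asboolT; last exact: rp_sentence.
by rewrite /rp; case: cid => a [/= sa ->].
Qed.

Hint Resolve rp_sentence : sent.

Lemma rp_cls a : sentence a -> T (Id (rp (cls a)) a).
Proof.
by move=> sa; apply/cls_eq => //; [exact: rp_sentence | rewrite rpK].
Qed.

Lemma quotP m : exists2 a, sentence a & m = cls a.
Proof. by exists (rp m); [exact: rp_sentence | rewrite rpK]. Qed.

(** * The quantifier on functions of classes *)

Definition denotes (t : quot -> quot) x phi : Prop :=
  forall a, sentence a -> t (cls a) = cls (subst phi x a).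

Definition is_All_of (t : quot -> quot) chi : Prop :=
  exists x phi, [/\ chi = All x phi, unary x phi & denotes t x phi].

(* A definable t that no formula with x free defines is constant; its value is
   then the interpretation of the quantifier at t. *)
Definition qall (t : quot -> quot) : quot :=
  match pselect (exists chi, is_All_of t chi) with
  | left h => cls (projT1 (cid h))
  | right _ => t (cls Bot)
  end.

(** The scheme [sch_All_Id] wants the same bound variable on both sides, so both formulas are first
    renamed to a common fresh [z]; its premise then follows by the omega rule. *)
Lemma T_Id_All x phi y psi : unary x phi -> unary y psi ->
  (forall a, sentence a -> T (Id (subst phi x a) (subst psi y a))) ->
  T (Id (All x phi) (All y psi)).
Proof.
move=> u u' h; pose z := fresh_bound phi + fresh_bound psi.
have zp : fresh_bound phi <= z by exact: leq_addr.
have zq : fresh_bound psi <= z by exact: leq_addl.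
have [zpf zpb] := (notin_fv_fresh zp, notin_bv_fresh zp).
have [zqf zqb] := (notin_fv_fresh zq, notin_bv_fresh zq).
apply: T_Id_trans (T_rename u zpf zpb) _.
apply: T_Id_trans _ (T_Id_sym (T_rename u' zqf zqb)).
have [v v'] := (unary_rename u zpb, unary_rename u' zqb).
apply: (@T_MP (All z (Id (subst phi x (Var z)) (subst psi y (Var z))))).
  apply: T_All => [|a sa]; first sent.
  have [_ fa] := sa.
  by rewrite subst_Id !subst_subst_Var //; exact: h.
by apply: T_Box; exact: nec_All_Id.
Qed.

Lemma qall_unary t x phi : unary x phi -> denotes t x phi ->
  qall t = cls (All x phi).
Proof.
move=> u dt; rewrite /qall; case: pselect => [h|[]]; last first.
  by exists (All x phi), x, phi.
case: cid => chi /= [y [psi [-> u' dt']]].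
apply/cls_eq; [sent | sent |]; apply: T_Id_All => // a sa.
by apply/cls_eq; [sent | sent |]; rewrite -dt // dt'.
Qed.

(** If no unary formula denotes [t], then [x] is not free in [phi], so [phi] is a sentence and [t]
    is constant at its class. *)
Lemma qall_cases t x phi : wf phi -> (forall z, z \in fv phi -> z = x) ->
  denotes t x phi ->
  (exists y psi, [/\ unary y psi, denotes t y psi & qall t = cls (All y psi)])
  \/ (exists2 a, sentence a & (forall m, t m = cls a) /\ qall t = cls a).
Proof.
move=> wp fp dt.
have [[chi [y [psi [_ u d]]]]|n] := pselect (exists chi, is_All_of t chi).
  by left; exists y, psi; split=> //; exact: qall_unary.
right; have xp : x \notin fv phi.
  by apply/negP => xp; apply: n; exists (All x phi), x, phi.
have sp : sentence phi.
  split=> //; case e: (fv phi) => [//|z r].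
  have zp : z \in fv phi by rewrite e inE eqxx.
  by move: xp; rewrite -(fp z zp) zp.
have tE m : t m = cls phi.
  by have [a sa ->] := quotP m; rewrite dt // subst_sentence.
by exists phi => //; split=> //; rewrite /qall; case: pselect.
Qed.

(** * The model and its operations on classes *)

Definition model : domain C :=
  @Domain C quot (fun m => T (rp m)) (fun m => T (Box (rp m)))
    (cls Bot) (cls Top) (fun m => cls (Box (rp m))) (fun m => cls (Neg (rp m)))
    (fun m n => cls (Or (rp m) (rp n))) (fun m n => cls (And (rp m) (rp n)))
    (fun m n => cls (Imp (rp m) (rp n))) (fun m n => cls (Id (rp m) (rp n)))
    qall (fun e : C => cls (Const (inl e : H))) erefl erefl.

Implicit Types (m n : model) (t : model -> model).

Lemma TRUE_cls a : sentence a -> @TRUE _ model (cls a) <-> T a.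
Proof.
move=> sa; have e := rp_cls sa; split; apply: T_Id_T => //.
exact: T_Id_sym.
Qed.

Lemma NEC_cls a : sentence a -> @NEC _ model (cls a) <-> T (Box a).
Proof.
move=> sa; have e := T_Id_Box (rp_cls sa); split; apply: T_Id_T => //.
exact: T_Id_sym.
Qed.

Lemma fbox_cls a : sentence a -> @fbox _ model (cls a) = cls (Box a).
Proof.
by move=> sa; apply/cls_eq; [sent | sent | exact/T_Id_Box/rp_cls].
Qed.

Lemma fneg_cls a : sentence a -> @fneg _ model (cls a) = cls (Neg a).
Proof.
by move=> sa; apply/cls_eq; [sent | sent | exact/T_Id_Neg/rp_cls].
Qed.

Lemma fimp_cls a b : sentence a -> sentence b ->
  @fimp _ model (cls a) (cls b) = cls (Imp a b).
Proof.
move=> sa sb; apply/cls_eq; [sent | sent |].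
by apply: T_Id_binary; [constructor 1 | exact: rp_cls | exact: rp_cls].
Qed.

Lemma for_cls a b : sentence a -> sentence b ->
  @for_ _ model (cls a) (cls b) = cls (Or a b).
Proof.
move=> sa sb; apply/cls_eq; [sent | sent |].
by apply: T_Id_binary; [constructor 2 | exact: rp_cls | exact: rp_cls].
Qed.

Lemma fand_cls a b : sentence a -> sentence b ->
  @fand _ model (cls a) (cls b) = cls (And a b).
Proof.
move=> sa sb; apply/cls_eq; [sent | sent |].
by apply: T_Id_binary; [constructor 3 | exact: rp_cls | exact: rp_cls].
Qed.

Lemma fid_cls a b : sentence a -> sentence b ->
  @fid _ model (cls a) (cls b) = cls (Id a b).
Proof.
move=> sa sb; apply/cls_eq; [sent | sent |].
by apply: T_Id_binary; [constructor 4 | exact: rp_cls | exact: rp_cls].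
Qed.

Lemma le_cls a b : sentence a -> sentence b ->
  @le _ model (cls a) (cls b) <-> T (Box (Imp a b)).
Proof. by move=> sa sb; rewrite /le fimp_cls //; apply: NEC_cls; sent. Qed.

(** * Boolean laws from boxed tautologies *)

Fixpoint pev (l : seq quot) (p : pform) : model :=
  match p with
  | PVar n => nth (cls Bot) l n
  | PTop => ftop model
  | PBot => fbot model
  | PNeg p => fneg (pev l p)
  | PImp p q => fimp (pev l p) (pev l q)
  | POr p q => for_ (pev l p) (pev l q)
  | PAnd p q => fand (pev l p) (pev l q)
  end.

Lemma sentence_rps l i : sentence (nth Bot (map rp l) i).
Proof.
case: (ltnP i (size l)) => h; last by rewrite nth_default ?size_map.
by rewrite (nth_map (cls Bot)) //; exact: rp_sentence.
Qed.

Lemma pev_pinst l p : pev l p = cls (pinst (nth Bot (map rp l)) p).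
Proof.
have s q : sentence (pinst (nth Bot (map rp l)) q).
  by apply: sentence_pinst => i; exact: sentence_rps.
elim: p => //= [i|p ->|p -> q ->|p -> q ->|p -> q ->].
- case: (ltnP i (size l)) => h; last by rewrite !nth_default ?size_map.
  by rewrite (nth_map (cls Bot)) // rpK.
- exact: fneg_cls.
- exact: fimp_cls.
- exact: for_cls.
- exact: fand_cls.
Qed.

Lemma pev_tautology l p : tautology p -> NEC (pev l p).
Proof.
have hl i := sentence_rps l i.
move=> tp; rewrite pev_pinst; apply/NEC_cls; first exact: sentence_pinst.
exact: nec_pinst.
Qed.

Lemma NEC_MP m n : NEC (fimp m n) -> NEC m -> NEC n.
Proof.
have [a sa ->] := quotP m; have [b sb ->] := quotP n.
rewrite fimp_cls // => /NEC_cls h /NEC_cls h'; apply/NEC_cls => //.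
by apply: nec_K (h _) (h' _); sent.
Qed.

Lemma TRUE_MP m n : TRUE (fimp m n) -> TRUE m -> TRUE n.
Proof.
have [a sa ->] := quotP m; have [b sb ->] := quotP n.
rewrite fimp_cls // => /TRUE_cls h /TRUE_cls h'; apply/TRUE_cls => //.
by apply: T_MP (h' _) (h _); sent.
Qed.

Lemma NEC_true m : NEC m -> TRUE m.
Proof. exact: T_Box. Qed.

(** Turns a tautology into a rule on elements of the model: the fold unfolds to a curried
    implication between [NEC] facts, and Boolean laws reduce to truth tables. *)
Lemma NEC_taut l ps q : tautology (foldr PImp q ps) ->
  foldr (fun p P => NEC (pev l p) -> P) (NEC (pev l q)) ps.
Proof.
move/(pev_tautology l); elim: ps => //= p ps IH h hp; apply: IH.
exact: NEC_MP h hp.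
Qed.

Lemma TRUE_taut l ps q : tautology (foldr PImp q ps) ->
  foldr (fun p P => TRUE (pev l p) -> P) (TRUE (pev l q)) ps.
Proof.
move/(pev_tautology l)/NEC_true; elim: ps => //= p ps IH h hp; apply: IH.
exact: TRUE_MP h hp.
Qed.

Local Ltac taut :=
  let v := fresh in intro v; simpl;
  case: (v 0); case: (v 1); case: (v 2); case: (v 3).
Local Notation x0 := (PVar 0).
Local Notation x1 := (PVar 1).
Local Notation x2 := (PVar 2).
Local Notation x3 := (PVar 3).

Lemma le_taut l p q : tautology (PImp p q) -> le (pev l p) (pev l q).
Proof. exact: pev_tautology. Qed.

Lemma model_le_trans m n k : le m n -> le n k -> le m k.
Proof.
by apply: (@NEC_taut [:: m; n; k] [:: PImp x0 x1; PImp x1 x2] (PImp x0 x2));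
  taut.
Qed.

Lemma model_le_refl m : le m m.
Proof. by apply: (@le_taut [:: m] x0 x0); taut. Qed.

Lemma le_curry m n k : le (fand m n) k -> le m (fimp n k).
Proof.
by apply: (@NEC_taut [:: m; n; k] [:: PImp (PAnd x0 x1) x2]
  (PImp x0 (PImp x1 x2))); taut.
Qed.

Lemma le_fand_app k l m n : le k (fimp m n) -> le l m -> le (fand k l) n.
Proof.
by apply: (@NEC_taut [:: k; l; m; n] [:: PImp x0 (PImp x2 x3); PImp x1 x2]
  (PImp (PAnd x0 x1) x3)); taut.
Qed.

Lemma model_boolean :
  boolean_prealgebra (fbot model) (ftop model) fneg for_ fand fimp (@le _ model).
Proof.
split.
- exact: model_le_refl.
- exact: model_le_trans.
- move=> m n [h h']; split; [move: h' | move: h].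
    by apply: (@NEC_taut [:: n; m] [:: PImp x0 x1]
      (PImp (PNeg x1) (PNeg x0))); taut.
  by apply: (@NEC_taut [:: m; n] [:: PImp x0 x1]
    (PImp (PNeg x1) (PNeg x0))); taut.
- have h m m' n n' : le m m' -> le n n' -> le (for_ m n) (for_ m' n').
    by apply: (@NEC_taut [:: m; m'; n; n'] [:: PImp x0 x1; PImp x2 x3]
      (PImp (POr x0 x2) (POr x1 x3))); taut.
  by move=> m m' n n' [? ?] [? ?]; split; exact: h.
- have h m m' n n' : le m m' -> le n n' -> le (fand m n) (fand m' n').
    by apply: (@NEC_taut [:: m; m'; n; n'] [:: PImp x0 x1; PImp x2 x3]
      (PImp (PAnd x0 x2) (PAnd x1 x3))); taut.
  by move=> m m' n n' [? ?] [? ?]; split; exact: h.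
- have h m m' n n' : le m' m -> le n n' -> le (fimp m n) (fimp m' n').
    by apply: (@NEC_taut [:: m; m'; n; n'] [:: PImp x1 x0; PImp x2 x3]
      (PImp (PImp x0 x2) (PImp x1 x3))); taut.
  by move=> m m' n n' [? ?] [? ?]; split; exact: h.
- have h m n : le (for_ m n) (for_ n m).
    by apply: (@le_taut [:: m; n] (POr x0 x1) (POr x1 x0)); taut.
  by split.
- have h m n : le (fand m n) (fand n m).
    by apply: (@le_taut [:: m; n] (PAnd x0 x1) (PAnd x1 x0)); taut.
  by split.
- move=> m n k; split.
    by apply: (@le_taut [:: m; n; k] (POr x0 (POr x1 x2)) (POr (POr x0 x1) x2));
      taut.
  by apply: (@le_taut [:: m; n; k] (POr (POr x0 x1) x2) (POr x0 (POr x1 x2)));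
    taut.
- move=> m n k; split.
    by apply: (@le_taut [:: m; n; k] (PAnd x0 (PAnd x1 x2))
      (PAnd (PAnd x0 x1) x2)); taut.
  by apply: (@le_taut [:: m; n; k] (PAnd (PAnd x0 x1) x2)
    (PAnd x0 (PAnd x1 x2))); taut.
- move=> m n; split.
    by apply: (@le_taut [:: m; n] (POr x0 (PAnd x0 x1)) x0); taut.
  by apply: (@le_taut [:: m; n] x0 (POr x0 (PAnd x0 x1))); taut.
- move=> m n; split.
    by apply: (@le_taut [:: m; n] (PAnd x0 (POr x0 x1)) x0); taut.
  by apply: (@le_taut [:: m; n] x0 (PAnd x0 (POr x0 x1))); taut.
- move=> m n k; split.
    by apply: (@le_taut [:: m; n; k] (PAnd x0 (POr x1 x2))
      (POr (PAnd x0 x1) (PAnd x0 x2))); taut.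
  by apply: (@le_taut [:: m; n; k] (POr (PAnd x0 x1) (PAnd x0 x2))
    (PAnd x0 (POr x1 x2))); taut.
- move=> m; split.
    by apply: (@le_taut [:: m] (POr x0 (PNeg x0)) PTop); taut.
  by apply: (@le_taut [:: m] PTop (POr x0 (PNeg x0))); taut.
- move=> m; split.
    by apply: (@le_taut [:: m] (PAnd x0 (PNeg x0)) PBot); taut.
  by apply: (@le_taut [:: m] PBot (PAnd x0 (PNeg x0))); taut.
- move=> m n; split.
    by apply: (@le_taut [:: m; n] (PImp x0 x1) (POr (PNeg x0) x1)); taut.
  by apply: (@le_taut [:: m; n] (POr (PNeg x0) x1) (PImp x0 x1)); taut.
- move=> m n; split=> [|[_]].
    move=> h; split; first by apply: (@le_taut [:: m; n] (PAnd x0 x1) x0); taut.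
    move: h; apply: (@NEC_taut [:: m; n] [:: PImp x0 x1]
      (PImp x0 (PAnd x0 x1))); by taut.
  by apply: (@NEC_taut [:: m; n] [:: PImp x0 (PAnd x0 x1)] (PImp x0 x1)); taut.
Qed.

Lemma model_normal : normal model.
Proof. by exists (ftop model); apply: (@NEC_taut [::] [::] PTop). Qed.

Lemma model_NEC_filter : NEC_filter model.
Proof.
split=> [|m n h h'|m n]; [exact: NEC_true | exact: NEC_MP h' h |].
by apply: (@NEC_taut [:: m; n] [:: x0; x1] (PAnd x0 x1)); taut.
Qed.

Lemma model_true_neg m : TRUE (fneg m) <-> ~ TRUE m.
Proof.
split=> [h h'|].
  suff /TRUE_cls hb : TRUE (fbot model) by apply: T_Bot; apply: hb; sent.
  by move: h' h; apply: (@TRUE_taut [:: m] [:: x0; PNeg x0] PBot); taut.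
have [a sa ->] := quotP m; rewrite fneg_cls // => h.
apply/TRUE_cls; first sent.
apply: T_ent; first sent.
by apply: mT => // Ta; apply: h; exact/TRUE_cls.
Qed.

(** * Denotation as substitution of sentences *)

Implicit Types (s : var -> form H) (p q : form C).

Lemma emb_subst s x p a : sentence a -> (forall i, sentence (s i)) ->
  subst (emb (update s x (Var x)) p) x a = emb (update s x a) p.
Proof.
move=> sa ss; rewrite subst_gsub; last exact: sentence_avoids.
rewrite /emb gsub_comp; last first.
  split=> // w; have [->|wx] := eqVneq w x; first by left; rewrite updateE.
  by right; rewrite updateN //; apply: avoids_closed; case: (ss w).
apply: gsub_ext => // w _; have [->|wx] := eqVneq w x.
  by rewrite !updateE /= updateE.
by rewrite !updateN // gsub_closed //; case: (ss w).
Qed.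

Lemma fv_emb s x p z : (forall i, sentence (s i)) ->
  z \in fv (emb (update s x (Var x)) p) -> z = x.
Proof.
move=> ss /fv_gsub_sub[[]//|[w _]]; have [->|wx] := eqVneq w x.
  by rewrite updateE inE => /eqP.
by rewrite updateN //; case: (ss w) => _ ->.
Qed.

Lemma wf_emb s x p : (forall i, sentence (s i)) -> wf p ->
  wf (emb (update s x (Var x)) p).
Proof.
move=> ss; apply: wf_gsub => // w; rewrite /update; case: eqP => // _.
by case: (ss w).
Qed.

Lemma unary_emb s x p : (forall i, sentence (s i)) -> wf p -> x \in fv p ->
  unary x (emb (update s x (Var x)) p).
Proof.
move=> ss wp xp; split; [exact: wf_emb | | by move=> z; exact: fv_emb].
by apply: fv_gsub_id => //; rewrite updateE.
Qed.

(** The truth lemma. In the quantifier case well-formedness puts [x] among the free variables of the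
    body, so the value of [qall] is fixed by [qall_unary]. *)
Lemma den_emb (g : var -> model) s p : (forall i, sentence (s i)) ->
  (forall i, g i = cls (s i)) -> wf p -> den g p = cls (emb s p).
Proof.
have sE q s' : (forall i, sentence (s' i)) -> wf q -> sentence (emb s' q).
  by move=> ? ?; exact: sentence_emb.
elim: p g s => [i|c|p IH|p IHp q IHq|p IHp q IHq|p IHp q IHq|p IHp q IHq|p IH
  |x p IH] g s ss gs.
- by move=> _; exact: gs.
- by [].
- move=> wp; have {IH} := IH g s ss gs wp => /= ->; exact: fneg_cls (sE _ _ _ _).
- case/andP=> wp wq; have {IHp IHq} := (IHp g s ss gs wp, IHq g s ss gs wq).
  by case=> /= -> ->; apply: fimp_cls; exact: sE.
- case/andP=> wp wq; have {IHp IHq} := (IHp g s ss gs wp, IHq g s ss gs wq).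
  by case=> /= -> ->; apply: for_cls; exact: sE.
- case/andP=> wp wq; have {IHp IHq} := (IHp g s ss gs wp, IHq g s ss gs wq).
  by case=> /= -> ->; apply: fand_cls; exact: sE.
- case/andP=> wp wq; have {IHp IHq} := (IHp g s ss gs wp, IHq g s ss gs wq).
  by case=> /= -> ->; apply: fid_cls; exact: sE.
- move=> wp; have {IH} := IH g s ss gs wp => /= ->; exact: fbox_cls (sE _ _ _ _).
case/andP=> xp wp; apply: qall_unary; first exact: unary_emb.
move=> a sa; rewrite emb_subst //; apply: IH => // i;
  by rewrite /update; case: eqP.
Qed.

(** The parameters supplied by the assignment are absorbed into the formula as representative
    sentences. *)
Lemma definable_by_denotes p x (g : var -> model) t : definable_by p x g t ->
  let phi := emb (update (fun i => rp (g i)) x (Var x)) p in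
  [/\ wf phi, forall z, z \in fv phi -> z = x, denotes t x phi &
      x \in fv p -> unary x phi].
Proof.
move=> [wp tE] phi; have ss i : sentence (rp (g i)) by exact: rp_sentence.
split; [exact: wf_emb | by move=> z; exact: fv_emb | | exact: unary_emb].
move=> a sa; rewrite tE emb_subst //; apply: den_emb => // i;
  by rewrite /update; case: eqP => // _; rewrite ?rpK.
Qed.

(** * Quantification as a greatest lower bound *)

Definition defn t : Prop := exists x phi,
  [/\ wf phi, forall z, z \in fv phi -> z = x & denotes t x phi].

Lemma definable_defn t : definable t -> defn t.
Proof.
move=> [p [x [g /definable_by_denotes[]]]] w f d _.
by exists x; eexists; split; [exact: w | exact: f | exact: d].
Qed.

Lemma defn_cases t : defn t ->
  (exists y psi,
    [/\ unary y psi, denotes t y psi & fall t = cls (All y psi) :> model])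
  \/ (exists2 a, sentence a &
        (forall m, t m = cls a) /\ fall t = cls a :> model).
Proof. by move=> [x [phi [w f d]]]; exact: qall_cases d. Qed.

Lemma fall_inst t m : defn t -> le (fall t) (t m).
Proof.
case/defn_cases=> [[y [psi [u d ->]]]|[a sa [-> ->]]]; last exact: model_le_refl.
have [a sa ->] := quotP m; rewrite d //; apply/le_cls; [sent | sent |].
exact: nec_All_inst.
Qed.

(** The omega rule is applied to [Box phi], and the Barcan formula then moves the box outside. *)
Lemma nec_All x phi : unary x phi ->
  (forall a, sentence a -> T (Box (subst phi x a))) -> T (Box (All x phi)).
Proof.
move=> u h; apply: T_MP (T_Box (nec_Barcan u)).
by apply: T_All => [|a sa]; [sent | rewrite subst_Box; exact: h].
Qed.

Lemma fall_glb t m : defn t -> (forall n, le m (t n)) -> le m (fall t).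
Proof.
case/defn_cases=> [[y [psi [u d ->]]]|[a sa [tE ->]]] h; last first.
  by rewrite -(tE m); exact: h.
have [b sb e] := quotP m; rewrite e; apply/le_cls; [sent | sent |].
apply: nec_K (nec_All_Imp_const sb u) _; apply: nec_All => [|a sa]; first sent.
rewrite subst_Imp subst_sentence //; apply/le_cls; [sent | sent |].
by rewrite -d // -e.
Qed.

Lemma defn_fbox t : defn t -> defn (fun m => fbox (t m)).
Proof.
move=> [x [phi [w f d]]]; exists x, (Box phi); split=> // a sa.
by rewrite d // subst_Box fbox_cls //; exact: sentence_subst_fv.
Qed.

(** Here the S3 scheme is essential: K yields only the material implication between the boxes, not
    the strict one. *)
Lemma fbox_mono m n : le m n -> le (fbox m) (fbox n).
Proof.
have [a sa ->] := quotP m; have [b sb ->] := quotP n.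
move=> /(le_cls sa sb) h; rewrite !fbox_cls //; apply/le_cls; [sent | sent |].
apply: T_MP h _; apply: T_Box; apply: (@nec_scheme 0) => [|v _]; first sent.
exact: sch_S3.
Qed.

(** * Verification of the model conditions *)

Lemma model_truth_conditions : truth_conditions model.
Proof.
split.
- by move=> h; apply: T_Bot; apply/TRUE_cls; [sent | exact: h].
- exact/NEC_true/(@NEC_taut [::] [::] PTop).
- move=> m n; split=> [h|[/model_true_neg|]].
  + have [hm|hm] := pselect (TRUE m); last by left.
    by right; exact: TRUE_MP h hm.
  + by apply: (@TRUE_taut [:: m; n] [:: PNeg x0] (PImp x0 x1)); taut.
  + by apply: (@TRUE_taut [:: m; n] [:: x1] (PImp x0 x1)); taut.
- exact: model_true_neg.
- move=> m n; split=> [h|[]].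
    split; move: h.
      by apply: (@TRUE_taut [:: m; n] [:: PAnd x0 x1] x0); taut.
    by apply: (@TRUE_taut [:: m; n] [:: PAnd x0 x1] x1); taut.
  by apply: (@TRUE_taut [:: m; n] [:: x0; x1] (PAnd x0 x1)); taut.
- move=> m n; split=> [h|[]].
  + have [hm|/model_true_neg hm] := pselect (TRUE m); [by left | right].
    by move: h hm; apply: (@TRUE_taut [:: m; n] [:: POr x0 x1; PNeg x0] x1); taut.
  + by apply: (@TRUE_taut [:: m; n] [:: x0] (POr x0 x1)); taut.
  + by apply: (@TRUE_taut [:: m; n] [:: x1] (POr x0 x1)); taut.
- by move=> m; apply: TRUE_cls; exact: rp_sentence.
- move=> m n; have [a sa ->] := quotP m; have [b sb ->] := quotP n.
  by rewrite fid_cls // (cls_eq sa sb); apply: TRUE_cls; sent.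
- move=> t /definable_defn /defn_cases[[y [psi [u d ->]]]|[a sa [tE ->]]] h.
    apply/TRUE_cls; first sent.
    apply: T_All => // a sa; apply/TRUE_cls; first sent.
    by rewrite -d.
  by rewrite -(tE (cls Bot)).
Qed.

Lemma defn_fimp p q x (g : var -> model) t1 t2 :
  definable_by p x g t1 -> definable_by q x g t2 ->
  defn (fun m => fimp (t1 m) (t2 m)).
Proof.
move=> [wp e1] [wq e2]; apply: definable_defn; exists (Imp p q), x, g.
by split=> [|m]; rewrite /= ?wp // e1 e2.
Qed.

Lemma le_NEC m n : NEC n -> le m n.
Proof. by apply: (@NEC_taut [:: m; n] [:: x1] (PImp x0 x1)); taut. Qed.

Lemma NEC_fid_refl m : NEC (fid m m).
Proof.
have [a sa ->] := quotP m; rewrite fid_cls //; apply/NEC_cls; first sent.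
exact: nec_Id_refl.
Qed.

Lemma model_order_conditions : order_conditions model.
Proof.
split.
- by move=> m; apply: le_NEC; exact: NEC_fid_refl.
- move=> m n; have [a sa ->] := quotP m; have [b sb ->] := quotP n.
  rewrite fid_cls // fimp_cls //; apply/le_cls; [sent | sent |].
  exact: nec_Id_Imp.
- move=> t [p [x [g dt]]] m n; have [w f d u] := definable_by_denotes dt.
  have [xp|xp] := boolP (x \in fv p).
    have [a sa ->] := quotP m; have [b sb ->] := quotP n.
    have {}u := u xp; rewrite !d // !fid_cls //; try sent.
    by apply/le_cls; [sent | sent | exact: nec_Id_subst].
  (* The substitution scheme requires [x] free. Otherwise [t] is constant, and a reflexive identity
     is necessary. *)
  case: dt => wp tE; suff -> : t m = t n by apply: le_NEC; exact: NEC_fid_refl.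
  have ss (g' : var -> model) i : sentence (rp (g' i)) by exact: rp_sentence.
  have gs (g' : var -> model) i : g' i = cls (rp (g' i)) by rewrite rpK.
  rewrite !tE (den_emb (ss _) (gs _) wp) [RHS](den_emb (ss _) (gs _) wp).
  congr cls; apply: gsub_ext => // i ip.
  by rewrite !updateN //; apply: contraNneq xp => <-.
- move=> m; have [a sa ->] := quotP m; rewrite fbox_cls //.
  apply/le_cls; [sent | sent |].
  by apply: (@nec_scheme 0) => [|v _]; [sent | exact: sch_T].
- move=> m n; have [a sa ->] := quotP m; have [b sb ->] := quotP n.
  rewrite fimp_cls // !fbox_cls ?fimp_cls //; try sent.
  apply/le_cls; [sent | sent |].
  by apply: (@nec_scheme 0) => [|v _]; [sent | exact: sch_K].
- move=> m n; have [a sa ->] := quotP m; have [b sb ->] := quotP n.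
  rewrite fimp_cls // (fbox_cls sa) (fbox_cls sb) fimp_cls; try sent.
  rewrite !fbox_cls; try sent.
  apply/le_cls; [sent | sent |].
  by apply: (@nec_scheme 0) => [|v _]; [sent | exact: sch_S3].
- move=> p q x g t1 t2 xp xq d1 d2.
  have [f1 u1 {}d1] : exists2 phi, unary x phi & denotes t1 x phi.
    have [_ _ ? /(_ xp) ?] := definable_by_denotes d1; by eexists; eassumption.
  have [f2 u2 {}d2] : exists2 phi, unary x phi & denotes t2 x phi.
    have [_ _ ? /(_ xq) ?] := definable_by_denotes d2; by eexists; eassumption.
  have d : denotes (fun m => fid (t1 m : model) (t2 m)) x (Id f1 f2).
    by move=> a sa; rewrite d1 // d2 // fid_cls ?subst_Id //; sent.
  have e : fall (fun m => fid (t1 m) (t2 m)) = cls (All x (Id f1 f2)) :> model.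
    by apply: qall_unary d; sent.
  rewrite e (qall_unary u1 d1 : fall t1 = _) (qall_unary u2 d2 : fall t2 = _).
  rewrite fid_cls; try sent.
  by apply/le_cls; [sent | sent | exact: nec_All_Id].
- move=> p q x g t1 t2 d1 d2; have d := defn_fimp d1 d2.
  have D1 : defn t1 by apply: definable_defn; exists p, x, g.
  have D2 : defn t2 by apply: definable_defn; exists q, x, g.
  (* Residuation reduces the claim to a lower bound for [t2]; [sch_All_Imp] would have no instance
     if [x] were missing from [p] or [q]. *)
  apply: le_curry; apply: fall_glb => // n.
  by apply: le_fand_app (fall_inst n D1); exact: (fall_inst n d).
- by move=> t /definable_defn d m; exact: fall_inst.
- move=> q x g t' sigma b dq [ws fs] ->.
  have D : defn t' by apply: definable_defn; exists q, x, g.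
  have ss (g' : var -> model) i : sentence (rp (g' i)) by exact: rp_sentence.
  have gs (g' : var -> model) i : g' i = cls (rp (g' i)) by rewrite rpK.
  (* A sentence defines a constant function, which makes the implication definable. *)
  have ds : definable_by sigma x g (fun=> den g sigma).
    split=> // m; rewrite (den_emb (ss _) (gs _)) //.
    rewrite [RHS](den_emb (ss _) (gs _)) //.
    by congr cls; apply: gsub_ext => // i; rewrite fs.
  have d := defn_fimp ds dq.
  apply: le_curry; apply: fall_glb => // n.
  by apply: le_fand_app (model_le_refl _); exact: (fall_inst n d).
- move=> t /definable_defn d; have db := defn_fbox d; split.
    by apply: fall_glb => // n; apply: fbox_mono; exact: fall_inst.
  case/defn_cases: (d) => [[y [psi [u dp e]]]|[a sa [tE e]]].
    have e' : fall (fun m => fbox (t m)) = cls (All y (Box psi)) :> model.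
      apply: qall_unary => // a sa; rewrite dp // subst_Box.
      by apply: fbox_cls; sent.
    rewrite e e' fbox_cls; last sent.
    by apply/le_cls; [sent | sent | exact: nec_Barcan].
  (* The boxed function could be denoted by a unary formula even if [t] is not, so its
     quantification is bounded by an instance instead of computed. *)
  by rewrite e -(tE (cls Bot)); exact: (fall_inst (cls Bot) db).
- move=> t /definable_defn /defn_cases[[y [psi [u d ->]]]|[a sa [tE ->]]] h.
    apply/NEC_cls; first sent.
    apply: nec_All => // a sa; apply/NEC_cls; first sent.
    by rewrite -d.
  by rewrite -(tE (cls Bot)).
Qed.

Lemma model_S3 : S3_model model.
Proof.
split=> *; [exact: model_boolean | exact: model_truth_conditions
  | exact: model_NEC_filter | exact: model_order_conditions].
Qed.

Lemma model_sat s p : (forall i, sentence (s i)) -> wf p -> T (emb s p) ->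
  @sat _ model (fun i => cls (s i)) p.
Proof.
move=> ss wp Tp; rewrite /sat (den_emb ss) //; apply/TRUE_cls => //.
exact: sentence_emb.
Qed.

End CanonicalModel.

Theorem theorem27 (C : signature) (Phi : form C -> Prop)
    (Phi_Fm : forall phi, Phi phi -> wf phi)
    (Phi_consistent : consistent Phi) :
  exists (M : domain C) (g : var -> M),
    [/\ S3_model M, normal M & forall phi, Phi phi -> sat g phi].
Proof.
have [T [PT sT hT cT mT]] := henkin_theory Phi_Fm Phi_consistent.
exists (model T), (fun n => cls T (free_const C n)).
split; [exact: model_S3 | exact: model_normal |] => phi Pphi.
by apply: model_sat => //; [exact: Phi_Fm | exact: PT].
Qed.
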